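(* Let $\eta$ be the real root of the polynomial $X^3+X^2+X-2$ and $\alpha=\log 2/\log(2/\eta)$. Let $A$ be a finite group with $\#A\ge3$ and symmetric generating set $S_A$ not containing the identity, and let $W=A\wr_XG_{012}$, where $G_{012}$ is the first Grigorchuk group with generating set $\{a,b,c,d\}$ and $X$ is the orbit of $x_0=1^\infty$. Then the critical threshold $\lambda_c$ for the firefighter problem on the Cayley graph of $W$ with respect to $S_A\cup\{a,b,c,d\}$ is $\alpha$; that is, for $\gamma\in(0,1)$, this Cayley graph satisfies intermediate containment of rate $\gamma$ if $\gamma>\alpha$, and does not if $\gamma<\alpha$.
   Context: Firefighting game: let $\mathcal{G}=(V,E)$ be a locally finite, connected, infinite graph and $g=(g_n)_{n\ge1}$ a sequence of nonnegative integers. An initial fire is a finite set $Z_0\subset V$; put $W_0=\emptyset$. At round $n\ge1$ one picks $S_n\subset V\setminus(Z_{n-1}\cup W_{n-1})$ with $\#S_n\le g_n$, and sets $$W_n=W_{n-1}\cup S_n,\qquad Z_n=Z_{n-1}\cup\{v\in V\setminus W_n:\ \exists u\in Z_{n-1},\ u\sim v\}.$$ The fire is contained if $\#\bigcup_{n\ge0}Z_n<\infty$. The graph $\mathcal{G}$ is $g$-containable if for every finite $Z_0\subset V$ there is a choice of sets $(S_n)_{n\ge1}$ with $S_n\subset V\setminus(Z_{n-1}\cup W_{n-1})$ and $\#S_n\le g_n$ for every $n\ge1$ for which the fire is contained. For $\gamma\in(0,1)$, $\mathcal{G}$ satisfies intermediate containment of rate $\gamma$ if there are $C>0$ and $g=(g_n)$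 with $g_n\le C\exp(n^{\gamma})$ for all $n\in\mathbb{N}$ such that $\mathcal{G}$ is $g$-containable. The critical parameter $\lambda_c(\mathcal{G})$ is the number such that $\mathcal{G}$ satisfies intermediate containment of rate $\gamma$ if $\gamma>\lambda_c$ and does not if $\gamma<\lambda_c$. First Grigorchuk group: $G_{012}$ is the group of automorphisms of the rooted binary tree (vertices: finite words over $\{0,1\}$), acting on infinite words $\{0,1\}^\infty$ from the right, generated by $a,b,c,d$ defined recursively: $a$ exchanges the first letter ($0w\leftrightarrow1w$); $b$ maps $0w\mapsto0\,a(w)$, $1w\mapsto1\,c(w)$; $c$ maps $0w\mapsto0\,a(w)$, $1w\mapsto1\,d(w)$; $d$ maps $0w\mapsto0w$, $1w\mapsto1\,b(w)$. Here $x_0=1^\infty=111\cdots$ and $X=x_0G_{012}$ is its orbit in $\{0,1\}^\infty$. Permutation wreath product: for a group $G$ acting on $X$ from the right and a group $A$, $\sum_XA$ is the group of finitely supported functions $f:X\to A$, and $A\wr_XG$ is the semidirect product whose elements are written $fg$ ($f\in\sum_XA$, $g\in G$) with $$(f_1g_1)\cdot(f_2g_2)=(g_2^{-1}\cdot f_1)\,f_2\,g_1g_2,\qquad (g^{-1}\cdot f)(x)=f(xg^{-1}).$$ An element $s\in A$ is identified with the function equal to $s$ at $x_0$ and to $1_A$ elsewhere. The Cayley graph joins $u$ to $us$ for each generator $s$. *)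

(* Defs.v *)
From HB Require Import structures.
From mathcomp Require Import all_boot all_order all_algebra all_fingroup.
From mathcomp Require Import boolp classical_sets cardinality reals sequences exp.

Set Implicit Arguments.
Unset Strict Implicit.
Unset Printing Implicit Defensive.

Local Open Scope classical_set_scope.
Local Open Scope card_scope.
Local Open Scope group_scope.

Section Firefighting.
Variables (V : Type) (adj : V -> V -> Prop).

(* In a sequence indexed by the rounds n >= 1 (S or g), the entry of index 0 is
   never used. *)
Fixpoint protected (S : nat -> set V) (n : nat) : set V :=
  if n is m.+1 then protected S m `|` S m.+1 else set0.

Fixpoint burning (Z0 : set V) (S : nat -> set V) (n : nat) : set V :=
  if n is m.+1 then
    burning Z0 S m `|`
      [set v | ~ protected S m.+1 v /\ exists2 u, burning Z0 S m u & adj u v]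
  else Z0.

Definition legal_strategy (g : nat -> nat) (Z0 : set V) (S : nat -> set V) : Prop :=
  forall n, S n.+1 `<=` ~` (burning Z0 S n `|` protected S n) /\
            S n.+1 #<= `I_(g n.+1).

Definition contained (Z0 : set V) (S : nat -> set V) : Prop :=
  finite_set (\bigcup_n burning Z0 S n).

Definition containable (g : nat -> nat) : Prop :=
  forall Z0 : set V, finite_set Z0 ->
  exists S : nat -> set V, legal_strategy g Z0 S /\ contained Z0 S.

Definition intermediate_containment (R : realType) (gamma : R) : Prop :=
  exists C : R, exists g : nat -> nat,
    [/\ (0 < C)%R,
        forall n, (0 < n)%N -> ((g n)%:R <= C * expR (powR n%:R gamma))%R &
        containable g].

Definition is_critical_parameter (R : realType) (lambda : R) : Prop :=
  forall gamma : R, (0 < gamma < 1)%R ->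
    ((lambda < gamma)%R -> intermediate_containment gamma) /\
    ((gamma < lambda)%R -> ~ intermediate_containment gamma).

End Firefighting.

Definition cayley_adj (G : groupType) (S : set G) (u v : G) : Prop :=
  exists2 s, S s & v = u * s \/ u = v * s.

Definition generated_subgroup (G : groupType) (S : seq G) : {pred G} :=
  fun g => `[< forall H : {pred G}, group_closed H -> {subset S <= H} ->
                 g \in H >].

Lemma generated_subgroup_closed (G : groupType) (S : seq G) :
  group_closed (generated_subgroup S).
Proof.
split; first by apply/asboolP => H [].
move=> x y /asboolP xS /asboolP yS; apply/asboolP => H Hgrp SH.
by apply: Hgrp.2; [exact: xS | exact: yS].
Qed.

Record right_action (G : groupType) (X : Type) := RightAction {
  ract :> X -> G -> X;
  ract1 : forall x, ract x 1 = x;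
  ractM : forall x g h, ract x (g * h) = ract (ract x g) h }.

Section Orbit.
Variables (G : groupType) (X : Type) (to : right_action G X) (x0 : X).

Definition orbit_type := {x : X | exists g, x = to x0 g}.

Lemma orbit_ract_subproof (x : orbit_type) (g : G) :
  exists h, to (sval x) g = to x0 h.
Proof. by case: x => x [h /= ->]; exists (h * g); rewrite ractM. Qed.

Definition orbit_ract (x : orbit_type) (g : G) : orbit_type :=
  exist _ (to (sval x) g) (orbit_ract_subproof x g).

Lemma orbit_ract1 x : orbit_ract x 1 = x.
Proof. by apply: eq_sig_hprop => [?|]; [exact: Prop_irrelevance|]; rewrite /= ract1. Qed.

Lemma orbit_ractM x g h : orbit_ract x (g * h) = orbit_ract (orbit_ract x g) h.
Proof. by apply: eq_sig_hprop => [?|]; [exact: Prop_irrelevance|]; rewrite /= ractM. Qed.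

Definition orbit_action := RightAction orbit_ract1 orbit_ractM.

Definition orbit_base : orbit_type :=
  exist _ x0 (ex_intro _ 1 (esym (ract1 to x0))).

End Orbit.

(* The carrier does not involve the action to, which is a parameter of the type
   because the group structure depends on it. *)
Record wreath (A G : groupType) (X : Type) (to : right_action G X) := Wreath {
  wfun : X -> A;
  wtop : G;
  wfun_finite : finite_set [set x | wfun x <> 1] }.

Section Wreath.
Variables (A G : groupType) (X : Type) (to : right_action G X).
Local Notation wreath := (wreath A to).
Local Notation Wreath := (@Wreath A G X to _).

Lemma wreath_eq (u v : wreath) : wfun u = wfun v -> wtop u = wtop v -> u = v.
Proof.
case: u v => [f g p] [f' g' p'] /= ff gg.
by case: _ / ff gg p' => <- p'; rewrite (Prop_irrelevance p p').
Qed.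

HB.instance Definition _ := gen_eqMixin wreath.
HB.instance Definition _ := gen_choiceMixin wreath.

Lemma ractK (g : G) : cancel (to^~ g) (to^~ g^-1).
Proof. by move=> x; rewrite -ractM mulgV ract1. Qed.

Lemma ractVK (g : G) : cancel (to^~ g^-1) (to^~ g).
Proof. by move=> x; rewrite -ractM mulVg ract1. Qed.

Lemma translate_finite (f : X -> A) (g : G) :
  finite_set [set x | f x <> 1] -> finite_set [set x | f (to x g) <> 1].
Proof.
move=> /(finite_image (to^~ g^-1)); apply: sub_finite_set => x /= fx.
by exists (to x g) => //; rewrite ractK.
Qed.

Lemma wreath1_finite : finite_set [set x : X | (1 : A) <> 1].
Proof. by apply: (sub_finite_set _ (finite_set0 X)) => x /=. Qed.

Definition wreath1 : wreath := Wreath 1 wreath1_finite.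

Lemma wreathM_finite (u v : wreath) :
  finite_set [set x | wfun u (to x (wtop v)^-1) * wfun v x <> 1].
Proof.
have fin_uv : finite_set ([set x | wfun u (to x (wtop v)^-1) <> 1] `|`
                          [set x | wfun v x <> 1]).
  by rewrite finite_setU; split; [exact/translate_finite/wfun_finite |
                                  exact: wfun_finite].
apply: sub_finite_set fin_uv => x /= uvx.
have [ux|ux] := pselect (wfun u (to x (wtop v)^-1) = 1).
  by right => vx; apply: uvx; rewrite ux vx mulg1.
by left.
Qed.

(* (f1 g1) (f2 g2) = (g2^-1 . f1) f2 g1 g2, where (g^-1 . f) x = f (x g^-1). *)
Definition wreathM (u v : wreath) : wreath :=
  Wreath (wtop u * wtop v) (wreathM_finite u v).

Lemma wreathV_finite (u : wreath) :
  finite_set [set x | (wfun u (to x (wtop u)))^-1 <> 1].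
Proof.
apply: sub_finite_set (translate_finite (wtop u) (wfun_finite u)) => x /= ux.
by move=> e; apply: ux; rewrite e invg1.
Qed.

Definition wreathV (u : wreath) : wreath :=
  Wreath (wtop u)^-1 (wreathV_finite u).

Lemma wreathMA : associative wreathM.
Proof.
move=> u v w; apply: wreath_eq; last exact: mulgA.
by apply/funext => x /=; rewrite mulgA invgM ractM.
Qed.

Lemma wreath1M : left_id wreath1 wreathM.
Proof.
move=> u; apply: wreath_eq; last exact: mul1g.
by apply/funext => x /=; rewrite mul1g.
Qed.

Lemma wreathM1 : right_id wreath1 wreathM.
Proof.
move=> u; apply: wreath_eq; last exact: mulg1.
by apply/funext => x /=; rewrite mulg1 invg1 ract1.
Qed.

Lemma wreathMV : right_inverse wreath1 wreathV wreathM.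
Proof.
move=> u; apply: wreath_eq; last exact: mulgV.
by apply/funext => x /=; rewrite invgK mulgV.
Qed.

Lemma wreathVM : left_inverse wreath1 wreathV wreathM.
Proof.
move=> u; apply: wreath_eq; last exact: mulVg.
by apply/funext => x /=; rewrite ractVK mulVg.
Qed.

HB.instance Definition _ :=
  isGroup.Build wreath wreathMA wreath1M wreathM1 wreathVM wreathMV.

Definition point_fun (x0 : X) (s : A) (x : X) : A :=
  if `[< x = x0 >] then s else 1.

Lemma point_fun_finite x0 s : finite_set [set x | point_fun x0 s x <> 1].
Proof.
apply: sub_finite_set (finite_set1 x0) => x /=; rewrite /point_fun.
by case: asboolP.
Qed.

Definition wreath_base (x0 : X) (s : A) : wreath :=
  Wreath 1 (point_fun_finite x0 s).

Definition wreath_lift (g : G) : wreath := Wreath g wreath1_finite.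

End Wreath.

Definition tree_edge (u v : seq bool) : Prop := exists i, v = rcons u i.

(* Edges are oriented away from the root, and the root is the only vertex
   without incoming edge, so that preserving these edges includes fixing it. *)
Record tree_aut := TreeAut {
  tree_fun :> seq bool -> seq bool;
  tree_inv : seq bool -> seq bool;
  tree_funK : cancel tree_fun tree_inv;
  tree_invK : cancel tree_inv tree_fun;
  tree_funE : forall u v, tree_edge (tree_fun u) (tree_fun v) <-> tree_edge u v }.

Lemma tree_aut_eq (g h : tree_aut) : tree_fun g = tree_fun h -> g = h.
Proof.
case: g h => [f f' fK f'K fE] [h h' hK h'K hE] /= fh.
case: _ / fh hK h'K hE => hK h'K hE.
have e : f' = h' by apply/funext => w; rewrite -[in LHS](h'K w) fK.
case: _ / e hK h'K => hK h'K.
by rewrite (Prop_irrelevance fK hK) (Prop_irrelevance f'K h'K)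
  (Prop_irrelevance fE hE).
Qed.

HB.instance Definition _ := gen_eqMixin tree_aut.
HB.instance Definition _ := gen_choiceMixin tree_aut.

Definition tree_aut1 : tree_aut :=
  @TreeAut id id (fun _ => erefl) (fun _ => erefl) (fun _ _ => iff_refl _).

(* Automorphisms act on the right: in a product the left factor acts first. *)
Definition tree_autM (g h : tree_aut) : tree_aut :=
  @TreeAut (h \o g) (tree_inv g \o tree_inv h)
    (can_comp (@tree_funK h) (@tree_funK g))
    (can_comp (@tree_invK g) (@tree_invK h))
    (fun u v => iff_trans (tree_funE h (g u) (g v)) (tree_funE g u v)).

Lemma tree_invE (g : tree_aut) u v :
  tree_edge (tree_inv g u) (tree_inv g v) <-> tree_edge u v.
Proof. by rewrite -(tree_funE g) !tree_invK. Qed.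

Definition tree_autV (g : tree_aut) : tree_aut :=
  TreeAut (@tree_invK g) (@tree_funK g) (@tree_invE g).

Lemma tree_autMA : associative tree_autM.
Proof. by move=> g h k; apply: tree_aut_eq. Qed.

Lemma tree_aut1M : left_id tree_aut1 tree_autM.
Proof. by move=> g; apply: tree_aut_eq. Qed.

Lemma tree_autM1 : right_id tree_aut1 tree_autM.
Proof. by move=> g; apply: tree_aut_eq. Qed.

Lemma tree_autVM : left_inverse tree_aut1 tree_autV tree_autM.
Proof.
by move=> g; apply: tree_aut_eq; apply/funext => w /=; rewrite tree_invK.
Qed.

Lemma tree_autMV : right_inverse tree_aut1 tree_autV tree_autM.
Proof.
by move=> g; apply: tree_aut_eq; apply/funext => w /=; rewrite tree_funK.
Qed.

HB.instance Definition _ :=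
  isGroup.Build tree_aut tree_autMA tree_aut1M tree_autM1 tree_autVM tree_autMV.

(* The letter of index n of the image of x is the last letter of the image of
   the prefix of x of length n + 1. *)
Definition word_act (x : nat -> bool) (g : tree_aut) : nat -> bool :=
  fun n => nth false (g (mkseq x n.+1)) n.

Lemma size_tree_aut (g : tree_aut) w : size (g w) = size w.
Proof.
elim/last_ind: w => [|w i IH]; last first.
  have [j ->] : tree_edge (g w) (g (rcons w i)) by apply/tree_funE; exists i.
  by rewrite !size_rcons IH.
case/lastP E: (g [::]) => [//|w i].
have : tree_edge w (g [::]) by exists i.
rewrite -[w](tree_invK g) => /(tree_funE g)[j] /(congr1 size).
by rewrite size_rcons.
Qed.

Lemma mkseq_word_act x (g : tree_aut) n : mkseq (word_act x g) n = g (mkseq x n).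
Proof.
elim: n => [|n IH].
  by apply/esym/size0nil; rewrite size_tree_aut.
have : tree_edge (g (mkseq x n)) (g (mkseq x n.+1)).
  by apply/tree_funE; exists (x n); rewrite mkseqS.
case=> j gxE; rewrite mkseqS IH /word_act gxE.
by rewrite nth_rcons size_tree_aut size_mkseq ltnn eqxx.
Qed.

Lemma word_act1 x : word_act x 1 = x.
Proof. by apply/funext => n; rewrite /word_act [LHS]nth_mkseq. Qed.

Lemma word_actM x g h : word_act x (g * h) = word_act (word_act x g) h.
Proof. by apply/funext => n; rewrite {2}/word_act mkseq_word_act. Qed.

Definition word_action : right_action tree_aut (nat -> bool) :=
  RightAction word_act1 word_actM.

Definition grig_a_fun (w : seq bool) : seq bool :=
  if w is x :: v then ~~ x :: v else [::].

(* The letters 0 and 1 are encoded by false and true. *)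
Fixpoint grig_b_fun (w : seq bool) : seq bool :=
  match w with
  | [::] => [::]
  | false :: v => false :: grig_a_fun v
  | true :: v => true :: grig_c_fun v
  end
with grig_c_fun (w : seq bool) : seq bool :=
  match w with
  | [::] => [::]
  | false :: v => false :: grig_a_fun v
  | true :: v => true :: grig_d_fun v
  end
with grig_d_fun (w : seq bool) : seq bool :=
  match w with
  | [::] => [::]
  | false :: v => false :: v
  | true :: v => true :: grig_b_fun v
  end.

Lemma grig_aK : involutive grig_a_fun.
Proof. by case=> //= x w; rewrite negbK. Qed.

Lemma grig_bcdK w :
  [/\ grig_b_fun (grig_b_fun w) = w, grig_c_fun (grig_c_fun w) = w &
      grig_d_fun (grig_d_fun w) = w].
Proof.
elim: w => [|[] w [IHb IHc IHd]] //=; first by rewrite IHb IHc IHd.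
by rewrite grig_aK.
Qed.

Lemma grig_bK : involutive grig_b_fun.
Proof. by move=> w; case: (grig_bcdK w). Qed.

Lemma grig_cK : involutive grig_c_fun.
Proof. by move=> w; case: (grig_bcdK w). Qed.

Lemma grig_dK : involutive grig_d_fun.
Proof. by move=> w; case: (grig_bcdK w). Qed.


Lemma tree_edge_cons x u v : tree_edge u v -> tree_edge (x :: u) (x :: v).
Proof. by case=> i ->; exists i. Qed.

Lemma grig_a_rcons w i : tree_edge (grig_a_fun w) (grig_a_fun (rcons w i)).
Proof. by case: w => [|x w] /=; [exists (~~ i) | exists i]. Qed.

Lemma grig_bcd_rcons w i :
  [/\ tree_edge (grig_b_fun w) (grig_b_fun (rcons w i)),
      tree_edge (grig_c_fun w) (grig_c_fun (rcons w i)) &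
      tree_edge (grig_d_fun w) (grig_d_fun (rcons w i))].
Proof.
elim: w => [|[] w [IHb IHc IHd]] /=.
- by case: i; split; eexists.
- by split; apply: tree_edge_cons.
- by split; apply: tree_edge_cons; [exact: grig_a_rcons.. | exists i].
Qed.

Lemma involutive_tree_funE (f : seq bool -> seq bool) :
  involutive f -> (forall w i, tree_edge (f w) (f (rcons w i))) ->
  forall u v, tree_edge (f u) (f v) <-> tree_edge u v.
Proof.
move=> fK fE u v; split=> -[i]; last by move=> ->.
by rewrite -{2}[v]fK => ->; rewrite -{1}[u]fK.
Qed.

Definition grig_a : tree_aut :=
  TreeAut grig_aK grig_aK (involutive_tree_funE grig_aK grig_a_rcons).

Definition grig_b : tree_aut :=
  TreeAut grig_bK grig_bK (involutive_tree_funE grig_bK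
    (fun w i => let: And3 h _ _ := grig_bcd_rcons w i in h)).

Definition grig_c : tree_aut :=
  TreeAut grig_cK grig_cK (involutive_tree_funE grig_cK
    (fun w i => let: And3 _ h _ := grig_bcd_rcons w i in h)).

Definition grig_d : tree_aut :=
  TreeAut grig_dK grig_dK (involutive_tree_funE grig_dK
    (fun w i => let: And3 _ _ h := grig_bcd_rcons w i in h)).

Definition grig_gens : seq tree_aut := [:: grig_a; grig_b; grig_c; grig_d].

Record G012 := MkG012 {
  G012_val :> tree_aut;
  G012_valP : generated_subgroup grig_gens G012_val }.

HB.instance Definition _ := [isSub for G012_val].
HB.instance Definition _ := [Choice of G012 by <:].
HB.instance Definition _ :=
  SubChoice_isSubGroup.Build tree_aut (generated_subgroup grig_gens) G012
    (generated_subgroup_closed grig_gens).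

Definition G012_action : right_action G012 (nat -> bool) :=
  @RightAction G012 (nat -> bool) (fun x g => word_act x (\val g))
    word_act1 (fun x g h => word_actM x (\val g) (\val h)).

Definition ones : nat -> bool := fun=> true.

Definition grig_wreath (A : groupType) : groupType :=
  wreath A (orbit_action G012_action ones).

Definition grig_wreath_gens (A : finGroupType) (SA : {set A}) :
    set (grig_wreath A) :=
  [set wreath_base _ (orbit_base G012_action ones) s | s in [set` SA]] `|`
  [set wreath_lift A _ g | g in [set g : G012 | \val g \in grig_gens]].

(* Main.v *)
From HB Require Import structures.
Require Import Defs.
From mathcomp Require Import all_boot all_order all_algebra all_fingroup.
From mathcomp Require Import boolp classical_sets cardinality reals sequences exp.
From mathcomp Require Import finmap zify ring lra.

Set Implicit Arguments.
Unset Strict Implicit.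
Unset Printing Implicit Defensive.

Import Order.TTheory GRing.Theory Num.Theory.

(** The threshold is [alpha] because a ball of large radius [n] has at most
    [exp (n ^ p)] elements for each [p > alpha], while a walk of length [n] along
    a single well chosen word can already reach [exp (c * n ^ alpha)] elements,
    by deciding which lamps it lights on its way.

    Containment above [alpha].  The binary tree splits into two halves, so an
    element of the wreath product is determined by a bit and by two elements of
    the same wreath product ([halves], [halves_unique]).  For the weights
    [weight_a] and [weight], with weight 0 for lamps, an element of weight [t]
    has halves of total weight at most [eta * (t + 1)] ([word_halves]); the
    equation satisfied by [eta] gives the same factor for the three letters [b],
    [c], [d] ([weight_halves]) and lets adjacent letters merge without becoming
    heavier ([weight_third]).  Iterating, an element is described by a binary
    tree.  If [p > alpha] then [2 (eta / 2) ^ p < 1], and concavity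
    of the power [p] bounds the size of that tree by [2 (t + 1) ^ p]
    ([short_codes]).  Hence for [alpha < p < gamma] the ball of radius [n] has
    [exp (O(n ^ p))] elements, and for large [n] the [exp (n ^ gamma)]
    firefighters of the single round [n] suffice to occupy the whole sphere that
    the fire is about to reach ([containable_sphere]).

    Escape below [alpha].  A walker follows an infinite word fixed by the
    substitution [zeta].  The element spelled by the image of a word [w] has two
    halves that are [w] up to factors [a], so the image meets twice as many
    sites of the orbit as [w] ([subst_site]), while its length grows by the
    factor [2 / eta].  Thus [j] steps lead to at least [c * j ^ alpha] sites
    ([news_growth]).  At each new site the walker is free to light the lamp or
    not, and these choices can be read off its position: among the paths given
    by all the choices, a proportion at most [2 ^ (- c * j ^ alpha)] is at a
    prescribed vertex at time [j].  Let the initial fire consist of all the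
    positions at a time [r].  Up to round [n] the firefighters occupy at most
    [n * C * exp (n ^ gamma)] vertices, and the sum over [n] of the proportions
    of paths that are at one of these vertices at time [r + n] is at most 1/2
    when [r] is large ([slow_firefighters]).  So half of the paths are never
    cut; the fire runs along them and occupies arbitrarily many vertices
    ([escape_not_containable]). *)

(** * Infinite words and sections of tree automorphisms *)

Definition scons (i : bool) (y : nat -> bool) : nat -> bool :=
  fun n => if n is m.+1 then y m else i.

Lemma scons_eta y : y = scons (y 0) (fun n => y n.+1).
Proof. by apply/funext; case. Qed.

Lemma scons_inj i j y z : scons i y = scons j z -> i = j /\ y = z.
Proof.
move=> e; split; first by have := congr1 (fun f => f 0) e.
by apply/funext => n; have := congr1 (fun f => f n.+1) e.
Qed.

Lemma mkseq_scons i y n : mkseq (scons i y) n.+1 = i :: mkseq y n.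
Proof.
rewrite /mkseq /= -[1]addn0 iotaDl -map_comp.
by congr (_ :: _); apply: eq_map.
Qed.

Definition splits (g : tree_aut) (sigma : bool) (h : bool -> tree_aut) :=
  forall i w, g (i :: w) = (i (+) sigma) :: h i w.

Lemma word_act_splits g sigma h i y : splits g sigma h ->
  word_act (scons i y) g = scons (i (+) sigma) (word_act y (h i)).
Proof.
move=> gh; apply/funext => n; rewrite /word_act mkseq_scons gh.
by case: n.
Qed.

Lemma splits1 : splits 1%g false (fun=> 1%g).
Proof. by move=> i w; rewrite addbF. Qed.

Lemma splitsM g sigma h g' sigma' h' :
  splits g sigma h -> splits g' sigma' h' ->
  splits (g * g')%g (sigma (+) sigma')
         (fun i => (h i * h' (i (+) sigma))%g).
Proof. by move=> gh gh' i w /=; rewrite gh gh' addbA. Qed.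

Lemma splits_unique g g' sigma h :
  splits g sigma h -> splits g' sigma h -> g = g'.
Proof.
move=> gh gh'; apply: tree_aut_eq; apply/funext => -[|i w].
  by rewrite (size0nil (size_tree_aut g [::])) (size0nil (size_tree_aut g' [::])).
by rewrite gh gh'.
Qed.

(** * The generators of the Grigorchuk group *)

Variant bcd := Lb | Lc | Ld.

Definition bcd_code (v : bcd) : option bool :=
  match v with Lb => None | Lc => Some false | Ld => Some true end.
Definition bcd_decode (i : option bool) : bcd :=
  match i with None => Lb | Some b => if b then Ld else Lc end.
Lemma bcd_codeK : cancel bcd_code bcd_decode.
Proof. by case. Qed.
HB.instance Definition _ := Equality.copy bcd (can_type bcd_codeK).

(** The two sections of [v] are [a] or [1] on words starting with [0], and
    [bcd_succ v] on words starting with [1]. *)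
Definition bcd_succ (v : bcd) : bcd :=
  match v with Lb => Lc | Lc => Ld | Ld => Lb end.

Definition tree_bcd (v : bcd) : tree_aut :=
  match v with Lb => grig_b | Lc => grig_c | Ld => grig_d end.

Definition bcd_sect0 (v : bcd) : tree_aut := if v == Ld then 1%g else grig_a.

Lemma splits_a : splits grig_a true (fun=> 1%g).
Proof. by move=> i w; rewrite addbT. Qed.

Lemma splits_bcd v :
  splits (tree_bcd v) false
    (fun i => if i then tree_bcd (bcd_succ v) else bcd_sect0 v).
Proof. by move=> i w; case: v; case: i. Qed.

Definition bcd_third (u v : bcd) : bcd :=
  match u, v with
  | Lb, Lc | Lc, Lb => Ld
  | Lb, Ld | Ld, Lb => Lc
  | Lc, Ld | Ld, Lc => Lb
  | _, _ => u
  end.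

Lemma tree_bcd_mul u v :
  (tree_bcd u * tree_bcd v = if u == v then 1 else tree_bcd (bcd_third u v))%g.
Proof.
suff E w : tree_bcd v (tree_bcd u w) =
    if u == v then w else tree_bcd (bcd_third u v) w.
  by apply: tree_aut_eq; apply/funext => w; rewrite /= E; case: eqP.
elim: w u v => [|[] w IH] u v; first by case: u; case: v.
  by rewrite (splits_bcd u true w) (splits_bcd v true) IH; case: u; case: v.
rewrite (splits_bcd u false w) (splits_bcd v false).
by case: u; case: v => //=; rewrite grig_aK.
Qed.

Lemma tree_bcdV v : ((tree_bcd v)^-1 = tree_bcd v)%g.
Proof. by apply/eqP; rewrite eq_sym -mulg_eq1 tree_bcd_mul eqxx. Qed.

Lemma grig_aV : (grig_a^-1 = grig_a)%g.
Proof.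
apply/eqP; rewrite eq_sym -mulg_eq1; apply/eqP/tree_aut_eq/funext => w.
exact: grig_aK.
Qed.

Lemma act_a i y : word_act (scons i y) grig_a = scons (~~ i) y.
Proof. by rewrite (word_act_splits _ _ splits_a) addbT word_act1. Qed.

Lemma act_bcd1 v y :
  word_act (scons true y) (tree_bcd v) =
  scons true (word_act y (tree_bcd (bcd_succ v))).
Proof. by rewrite (word_act_splits _ _ (splits_bcd v)). Qed.

Lemma act_bcd0 v y :
  word_act (scons false y) (tree_bcd v) = scons false (word_act y (bcd_sect0 v)).
Proof. by rewrite (word_act_splits _ _ (splits_bcd v)). Qed.

Lemma act_aK : involutive (word_act^~ grig_a).
Proof. by move=> y; rewrite [y]scons_eta !act_a negbK. Qed.

Lemma act_ones v : word_act ones (tree_bcd v) = ones.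
Proof.
apply/funext => n; elim: n v => [|n IH] v; rewrite [in LHS](scons_eta ones).
  by rewrite act_bcd1.
by rewrite act_bcd1 /= -[RHS](IH (bcd_succ v)).
Qed.

(** * A substitution spreading the inverted orbit *)

(** A word [v1 ... vn] over [bcd] stands for [h = a v1 ... a vn]; [back] is the
    action of the inverse of [h]. *)
Definition back (w : seq bcd) (y : nat -> bool) : nat -> bool :=
  foldr (fun v z => word_act (word_act z (tree_bcd v)) grig_a) y w.

Lemma back_cat u w y : back (u ++ w) y = back u (back w y).
Proof. by rewrite /back foldr_cat. Qed.

Definition zeta (v : bcd) : seq bcd :=
  match v with
  | Lb => [:: Lb; Ld; Lc]
  | Lc => [:: Lb; Lb]
  | Ld => [:: Lc; Lc]
  end.

Definition subst (w : seq bcd) : seq bcd := flatten (map zeta w).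

Lemma subst_cat u w : subst (u ++ w) = subst u ++ subst w.
Proof. by rewrite /subst map_cat flatten_cat. Qed.

(** Both halves of the element spelled by [subst w] are [w] up to factors [a]:
    they are [a w a] and [w] if [w] has an even number of letters [Lb], and [a w]
    and [w a], exchanged, otherwise.  Applying [a] behind the letter [0] absorbs these factors, so
    that [back_subst] has a single form. *)
Definition twist (p : bool) (z : nat -> bool) : nat -> bool :=
  if p then scons false (word_act z grig_a) else scons true z.

Lemma twist_inj p q y z : twist p y = twist q z -> p = q /\ y = z.
Proof.
by case: p; case: q => /scons_inj[] // _; split=> //; apply: (can_inj act_aK).
Qed.

Lemma act_a_ones : word_act ones grig_a = twist true (word_act ones grig_a).
Proof. by rewrite /twist act_aK [in LHS](scons_eta ones) act_a. Qed.

Lemma back_zeta v p z :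
  back (zeta v) (twist p z) =
  twist (p (+) (v == Lb)) (word_act (word_act z (tree_bcd v)) grig_a).
Proof.
have act_d0 y : word_act (scons false y) grig_d = scons false y.
  by rewrite (act_bcd0 Ld) word_act1.
rewrite /twist; case: v; case: p => /=;
  do 7?[rewrite ?(act_d0, act_bcd0 Lb, act_bcd0 Lc, act_bcd1 Lb, act_bcd1 Lc,
                  act_bcd1 Ld, act_a) /= ?act_aK].
all: by rewrite // -word_actM (tree_bcd_mul Ld Lc).
Qed.

Definition parity (w : seq bcd) : bool := odd (count_mem Lb w).

Lemma back_subst w p z :
  back (subst w) (twist p z) = twist (p (+) parity w) (back w z).
Proof.
elim: w => [|v w IH] /=; first by rewrite addbF.
by rewrite back_cat IH back_zeta /parity /= oddD oddb -addbA (addbC (odd _)).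
Qed.

(** Write the prefix of length [i] as [u v] with a last letter [v].  Since [v]
    fixes [ones], its site is the image under [back u] of the site [a ones] of
    [v].  The inner prefixes of [zeta v] have both twists of [a ones] as sites
    (the first letter gives one, the first two letters give the other), and
    by [back_subst], prepending [subst u] applies [back u] behind the twist, which
    is flipped according to [parity u]. *)
Lemma subst_site w i p : 0 < i <= size w ->
  exists2 j, 0 < j <= size (subst w) &
    back (take j (subst w)) ones = twist p (back (take i w) ones).
Proof.
move=> /andP[i0 iw].
have [u [v [x [-> ->]]]] : exists u v x, w = rcons u v ++ x /\ take i w = rcons u v.
  exists (take i.-1 w), (nth Lb w i.-1), (drop i w); split; last first.
    by rewrite -take_nth ?prednK.
  by rewrite -take_nth prednK // cat_take_drop.
have sizeE : size (subst (rcons u v ++ x)) =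
    size (subst u) + size (zeta v) + size (subst x).
  by rewrite -cats1 !subst_cat !size_cat /= addn0.
have takeE k : k <= size (zeta v) ->
    take (size (subst u) + k) (subst (rcons u v ++ x)) =
    subst u ++ take k (zeta v).
  move=> kv; rewrite -cats1 !subst_cat /subst /= cats0 -catA takeD.
  by rewrite take_size_cat // drop_size_cat // takel_cat.
have siteE k y : back (take k (zeta v)) ones = twist y (word_act ones grig_a) ->
    k <= size (zeta v) ->
    back (take (size (subst u) + k) (subst (rcons u v ++ x))) ones =
    twist (y (+) parity u) (back (rcons u v) ones).
  move=> yk kv; rewrite takeE // back_cat yk back_subst -cats1 back_cat /=.
  by rewrite act_ones.
suff [k [kv yk]] : exists k, 0 < k <= size (zeta v) /\
    back (take k (zeta v)) ones = twist (p (+) parity u) (word_act ones grig_a).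
  case/andP: kv => k0 kv; exists (size (subst u) + k).
    rewrite sizeE; apply/andP; split; first by rewrite addn_gt0 k0 orbT.
    by rewrite -addnA leq_add2l; apply: leq_trans kv (leq_addr _ _).
  by rewrite (siteE _ _ yk kv) -addbA addbb addbF.
move=> {siteE takeE sizeE}; case: (p (+) parity u).
  exists 1; split; first by case: v.
  by rewrite -act_a_ones; case: v => /=; rewrite ?(act_ones Lb) ?(act_ones Lc).
have a1 : word_act ones grig_a = scons false ones.
  by rewrite [in LHS](scons_eta ones) act_a.
exists 2; split; first by case: v.
case: v => /=; rewrite ?(act_ones Lb, act_ones Lc, act_ones Ld) a1.
- by rewrite (act_bcd0 Lb) act_a a1.
- by rewrite (act_bcd0 Lb) act_a a1.
- by rewrite (act_bcd0 Lc) act_a a1.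
Qed.

Definition subst_iter (k : nat) : seq bcd := iter k subst [:: Lb].

(** The sites double at each iteration because [twist] is injective. *)
Lemma subst_iter_sites k :
  exists I : seq nat,
    [/\ size I = 2 ^ k, uniq [seq back (take i (subst_iter k)) ones | i <- I]
      & all (fun i => 0 < i <= size (subst_iter k)) I].
Proof.
elim: k => [|k [I [sI uI /allP aI]]]; first by exists [:: 1].
have /choice[f fP] : forall pi : bool * nat, exists j, pi.2 \in I ->
    0 < j <= size (subst_iter k.+1) /\
    back (take j (subst_iter k.+1)) ones =
      twist pi.1 (back (take pi.2 (subst_iter k)) ones).
  case=> p i; have [iI|_] := boolP (i \in I); last by exists 0.
  by have [j] := subst_site p (aI _ iI); exists j.
pose J := allpairs pair [:: false; true] I.
have JP pi : pi \in J -> pi.2 \in I by case/allpairsP => -[p i] /= [_ iI ->].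
exists (map f J); split.
- by rewrite size_map size_allpairs sI expnS.
- rewrite -map_comp.
  have -> : [seq (fun i => back (take i (subst_iter k.+1)) ones) (f j) | j <- J]
     = [seq twist pi.1 (back (take pi.2 (subst_iter k)) ones) | pi <- J].
    by apply/eq_in_map => pi /JP /(fP pi) [].
  have -> : [seq twist pi.1 (back (take pi.2 (subst_iter k)) ones) | pi <- J]
     = allpairs twist [:: false; true]
         [seq back (take i (subst_iter k)) ones | i <- I].
    by rewrite /J /= !map_cat -!map_comp.
  apply: allpairs_uniq => // -[p z] [q y] _ _ /= /twist_inj[-> ->] //.
- by apply/allP => _ /mapP[pi /JP piI ->]; have [] := fP pi piI.
Qed.

Lemma size_subst_iter k : 2 ^ k <= size (subst_iter k).
Proof.
elim: k => //= k IH; rewrite expnS.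
apply: (@leq_trans (2 * size (subst_iter k))); first by rewrite leq_mul2l.
elim: (subst_iter k) => // v w IHw; rewrite /subst /= size_cat mulnS.
by apply: leq_add => //; case: v.
Qed.

(** The iterates extend each other because [zeta Lb] starts with [Lb]. *)
Lemma prefix_subst_iter k n :
  take (size (subst_iter k)) (subst_iter (k + n)) = subst_iter k.
Proof.
have step m : prefix (subst_iter m) (subst_iter m.+1).
  elim: m => // m /prefixP[w e].
  have -> : subst_iter m.+2 = subst (subst_iter m ++ w) by rewrite -e.
  by rewrite subst_cat prefix_prefix.
elim: n => [|n IH]; first by rewrite addn0 take_size.
have /prefixP[w e] := step (k + n); rewrite addnS e -[RHS]IH takel_cat //.
have := congr1 size IH; rewrite size_take_min => <-; exact: geq_minr.
Qed.

(** The infinite word fixed by the substitution and starting with [Lb]. *)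
Definition spread_letter (n : nat) : bcd := nth Lb (subst_iter n) n.

Lemma mkseq_spread_letter n k : n <= size (subst_iter k) ->
  mkseq spread_letter n = take n (subst_iter k).
Proof.
move=> nk; apply: (@eq_from_nth _ Lb) => [|i].
  by rewrite size_mkseq size_takel.
rewrite size_mkseq => ltin; rewrite nth_mkseq // nth_take // /spread_letter.
have ii : i < size (subst_iter i) by apply: leq_trans (size_subst_iter i); apply: ltn_expl.
have ik : i < size (subst_iter k) by apply: leq_trans nk.
case: (leqP i k) => [le|/ltnW le]; rewrite -(subnKC le).
  by rewrite -[in LHS](prefix_subst_iter i (k - i)) nth_take.
by rewrite subnKC // -[in RHS](prefix_subst_iter k (i - k)) nth_take // subnKC.
Qed.

(** * Elements of the wreath product and their two halves *)

Local Notation orb := (orbit_action G012_action ones).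
Local Notation base := (orbit_base G012_action ones).

Lemma generated_gen (S : seq tree_aut) g : g \in S -> generated_subgroup S g.
Proof. by move=> gS; apply/asboolP => H _ SH; apply: SH. Qed.

Lemma grig_a_gen : grig_a \in grig_gens.
Proof. by rewrite inE eqxx. Qed.

Lemma tree_bcd_gen v : tree_bcd v \in grig_gens.
Proof. by rewrite !inE; case: v; rewrite eqxx ?orbT. Qed.

Definition ga : G012 := MkG012 (generated_gen grig_a_gen).
Definition gbcd (v : bcd) : G012 := MkG012 (generated_gen (tree_bcd_gen v)).

Section Halves.
Variable A : groupType.
Local Notation W := (grig_wreath A).

Definition lamp (s : A) : W := wreath_base orb base s.
Definition wlift (g : G012) : W := wreath_lift A orb g.

Lemma wfunM (x z : W) y :
  wfun (x * z)%g y = (wfun x (orb y (wtop z)^-1) * wfun z y)%g.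
Proof. by []. Qed.

Lemma wfun_wlift g y : wfun (wlift g) y = 1%g.
Proof. by []. Qed.

Lemma wtop_wlift g : wtop (wlift g) = g.
Proof. by []. Qed.

(** Lamp configurations are extended by [1] outside of the orbit, so that the
    two halves of a configuration are defined without knowing which words [0y]
    and [1y] are in the orbit. *)
Definition wfun_ext (x : W) (y : nat -> bool) : A :=
  if pselect (exists g, y = G012_action ones g) is left e
  then wfun x (exist _ y e) else 1%g.

Lemma wfun_extE (x : W) z : wfun_ext x (sval z) = wfun x z.
Proof.
rewrite /wfun_ext; case: pselect => [e|[]]; last exact: (svalP z).
by congr (wfun x _); apply: eq_sig_hprop => // ?; exact: Prop_irrelevance.
Qed.

Lemma wfun_extM (x z : W) y :
  wfun_ext (x * z)%g y =
  (wfun_ext x (word_act y (val (wtop z))^-1%g) * wfun_ext z y)%g.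
Proof.
have [orby|norby] := pselect (exists g, y = G012_action ones g).
  have -> : y = sval (exist _ y orby : orbit_type G012_action ones) by [].
  by rewrite wfun_extE -[word_act _ _]/(sval (orb _ (wtop z)^-1)%g) !wfun_extE.
rewrite /wfun_ext; case: pselect => // _.
case: pselect => [[g yg]|_]; last by rewrite mulg1.
case: norby; exists (g * wtop z)%g.
by rewrite ractM -yg /= -word_actM mulVg word_act1.
Qed.

Definition halves (x : W) (sigma : bool) (z : bool -> W) : Prop :=
  splits (val (wtop x)) sigma (fun i => val (wtop (z i))) /\
  forall i y, wfun_ext x (scons (i (+) sigma) y) = wfun_ext (z i) y.

Lemma halvesM x sigma z x' sigma' z' :
  halves x sigma z -> halves x' sigma' z' ->
  halves (x * x')%g (sigma (+) sigma') (fun i => (z i * z' (i (+) sigma))%g).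
Proof.
move=> [xs xf] [xs' xf']; split; first exact: splitsM xs xs'.
move=> i y; rewrite !wfun_extM addbA xf'; congr (_ * _)%g.
rewrite -xf; congr (wfun_ext x _).
have e : scons (i (+) sigma (+) sigma') y =
    word_act (scons (i (+) sigma)
      (word_act y (val (wtop (z' (i (+) sigma))))^-1%g)) (val (wtop x')).
  by rewrite (word_act_splits _ _ xs') -word_actM mulVg word_act1.
by rewrite e -word_actM mulgV word_act1.
Qed.

Lemma halves_unique x x' sigma z : halves x sigma z -> halves x' sigma z -> x = x'.
Proof.
move=> [xs xf] [xs' xf']; apply: wreath_eq; last first.
  by apply/val_inj; exact: splits_unique xs xs'.
apply/funext => y; rewrite -!wfun_extE [sval y]scons_eta.
by rewrite -[sval y 0](addbK sigma) xf xf'.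
Qed.

Lemma wfun_ext_lift g y : wfun_ext (wlift g) y = 1%g.
Proof. by rewrite /wfun_ext; case: pselect. Qed.

Lemma wfun_ext1 y : wfun_ext (1%g : W) y = 1%g.
Proof. exact: (wfun_ext_lift 1%g y). Qed.

Lemma wfun_ext_lamp s y :
  wfun_ext (lamp s) y = if `[< y = ones >] then s else 1%g.
Proof.
have [orby|norby] := pselect (exists g, y = G012_action ones g).
  have yE : y = sval (exist _ y orby : orbit_type G012_action ones) by [].
  rewrite [in LHS]yE wfun_extE /= /point_fun.
  congr (if _ then _ else _); apply/asboolP/asboolP => [/(congr1 sval)//|e].
  by apply: eq_sig_hprop => [?|//]; exact: Prop_irrelevance.
rewrite /wfun_ext; case: pselect => // _; case: asboolP => // e.
by case: norby; exists 1%g; rewrite ract1.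
Qed.

Lemma halves1 : halves 1%g false (fun=> 1%g).
Proof.
split=> [|i y]; first exact: splits1.
by rewrite !wfun_ext1.
Qed.

(** The lamp stands at [ones], which is in the half of the words starting
    with [1]. *)
Lemma halves_lamp s : halves (lamp s) false (fun i => if i then lamp s else 1%g).
Proof.
split=> [[] w|i y] //; rewrite addbF wfun_ext_lamp; case: i; last first.
  rewrite wfun_ext1.
  by case: asboolP => //; rewrite (scons_eta ones) => /scons_inj[].
rewrite wfun_ext_lamp; congr (if _ then _ else _).
rewrite [in LHS](scons_eta ones).
by apply/asboolP/asboolP => [/scons_inj[]|->].
Qed.

Lemma halves_a : halves (wlift ga) true (fun=> 1%g).
Proof.
split=> [|i y]; first exact: splits_a.
by rewrite wfun_ext_lift wfun_ext1.
Qed.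

Definition half0 (v : bcd) : W := if v == Ld then 1%g else wlift ga.

Lemma halves_bcd v :
  halves (wlift (gbcd v)) false
    (fun i => if i then wlift (gbcd (bcd_succ v)) else half0 v).
Proof.
split=> [i w|i y]; first by rewrite [LHS]splits_bcd; case: i => //; case: v.
by rewrite wfun_ext_lift /half0; case: i; case: v; rewrite (wfun_ext_lift, wfun_ext1).
Qed.
End Halves.

(** * Many diverging paths cannot all be cut *)

Lemma card_le_seq (V : choiceType) (A : set V) k :
  (A #<= `I_k)%card -> exists2 s : seq V, size s <= k & forall x, A x -> x \in s.
Proof.
move=> Ak; have finA : finite_set A by apply: card_le_finite Ak _.
exists (fset_set A) => [|x Ax]; first exact: geq_card_fset_set.
by rewrite in_fset_set //; exact/mem_set.
Qed.

Lemma protected_seq (V : choiceType) (adj : V -> V -> Prop) g Z0 S n :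
  legal_strategy adj g Z0 S ->
  exists2 s : seq V, size s <= \sum_(m < n) g m.+1 &
    forall x, protected S n x -> x \in s.
Proof.
move=> legal; elim: n => [|n [s ss Ps]]; first by exists [::].
have [t tt Pt] := card_le_seq (legal n).2.
exists (s ++ t) => [|x [/Ps|/Pt] h]; rewrite ?mem_cat ?h ?orbT //.
by rewrite size_cat big_ord_recr leq_add.
Qed.

Definition extend_ffun (T : nat) (e : {ffun 'I_T -> bool}) (i : nat) : bool :=
  if insub i is Some k then e k else false.

(** Prescribing the choices on [J] leaves at most one path out of [2 ^ size J]. *)
Lemma card_agree (T : nat) (J : seq nat) (e0 : {ffun 'I_T -> bool}) :
  uniq J -> (forall i, i \in J -> i < T) ->
  #|[set e : {ffun 'I_T -> bool} | all (fun i => extend_ffun e i == extend_ffun e0 i) J]|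
    * 2 ^ size J <= 2 ^ T.
Proof.
move=> uJ JT; pose I := [set i : 'I_T | val i \in J].
have sJ : size J <= #|I|.
  rewrite cardE -(size_map val); apply: uniq_leq_size => // i iJ.
  by apply/mapP; exists (Ordinal (JT i iJ)); rewrite // mem_enum inE.
have -> : 2 ^ T = 2 ^ #|~: I| * 2 ^ #|I|.
  by rewrite -expnD addnC cardsC card_ord.
apply: leq_mul; last by rewrite leq_exp2l.
rewrite -card_bool -(card_pffun_on false).
(* Adding [e0] turns agreement with [e0] on [I] into vanishing on [I]. *)
pose xor (e : {ffun 'I_T -> bool}) : {ffun 'I_T -> bool} :=
  [ffun i => e i (+) e0 i].
rewrite -(card_imset _ (f := xor)); last first.
  move=> e e' /ffunP xe; apply/ffunP => i; have := xe i; rewrite !ffunE.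
  exact: addIb.
apply: subset_leq_card; apply/fintype.subsetP => _ /imsetP[e + ->].
rewrite inE => /allP agree; apply/pffun_onP; split=> //.
apply/fintype.subsetP => i; rewrite !inE ffunE; apply: contraNN => iJ.
have := agree _ iJ; rewrite /extend_ffun valK => /eqP->.
by rewrite addbb.
Qed.

(** A path [q e] depends on infinitely many binary choices [e]; its position at
    time [j] depends on choices made by then, and reveals those in [J j]. *)
Section Escape.
Variables (V : choiceType) (adj : V -> V -> Prop) (g : nat -> nat).
Variables (q : (nat -> bool) -> nat -> V) (J : nat -> seq nat) (r : nat).
Hypothesis q_step : forall e j, q e j.+1 = q e j \/ adj (q e j) (q e j.+1).
Hypothesis q_local : forall e e' j, (forall i, i <= j -> e i = e' i) -> q e j = q e' j.
Hypothesis q_inj : forall e e' j, q e j = q e' j -> forall i, i \in J j -> e i = e' i.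
Hypothesis J_uniq : forall j, uniq (J j).
Hypothesis J_le : forall j i, i \in J j -> i <= j.

Lemma card_paths_to T (s : seq V) j : j < T ->
  #|[set e : {ffun 'I_T -> bool} | q (extend_ffun e) j \in s]| * 2 ^ size (J j)
    <= size s * 2 ^ T.
Proof.
move=> jT; elim: s => [|v s IH].
  by rewrite eq_card0 // => e; rewrite !inE.
have -> : [set e : {ffun 'I_T -> bool} | q (extend_ffun e) j \in v :: s] =
  [set e | q (extend_ffun e) j == v] :|: [set e | q (extend_ffun e) j \in s].
  by apply/setP=> e; rewrite !inE.
apply: (@leq_trans (2 ^ T + size s * 2 ^ T)); last by rewrite mulSn.
apply: leq_trans (leq_mul (leq_card_setU _ _) (leqnn _)) _.
rewrite mulnDl; apply: leq_add => //.
have [->|[e0]] := set_0Vmem [set e : {ffun 'I_T -> bool} | q (extend_ffun e) j == v].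
  by rewrite cards0.
rewrite inE => /eqP e0v.
apply: leq_trans (card_agree e0 (J_uniq j) _); last first.
  by move=> i /J_le ij; apply: leq_ltn_trans jT.
apply: leq_mul => //; apply: subset_leq_card; apply/fintype.subsetP => e.
rewrite !inE => /eqP ev; apply/allP => i iJ; apply/eqP.
by apply: q_inj iJ; rewrite ev e0v.
Qed.

Hypothesis J_unbounded : forall m, exists j0, forall j, j0 <= j -> m <= size (J j).
Hypothesis g_small : forall n, 0 < n ->
  (\sum_(m < n) g m.+1) * (2 * (n * n.+1)) <= 2 ^ size (J (r + n)).

(** The sum of [1 / ((n + 1) (n + 2))] over [n < N] telescopes to
    [N / (N + 1)]. *)
Lemma bad_union_bound (T : finType) (K : nat) (bad : nat -> {set T}) N :
  (forall n, n < N -> #|bad n| * (2 * (n.+1 * n.+2)) <= K) ->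
  2 * N.+1 * #|\bigcup_(n < N) bad n| <= N * K.
Proof.
elim: N => [|N IH] bK; first by rewrite big_ord0 cards0 muln0.
have {}IH := IH (fun n nN => bK n (leqW nN)); have {}bK := bK N (leqnn _).
rewrite big_ord_recr /=.
have := leq_card_setU (\bigcup_(n < N) bad n) (bad N).
move: #|_ :|: _| #|\bigcup_(_ < _) _| #|bad N| IH bK => u b c IH bK ubc.
rewrite -(leq_pmul2l (ltn0Sn N)).
apply: (@leq_trans (N.+2 * (2 * N.+1 * b) + c * (2 * (N.+1 * N.+2)))).
  by rewrite (_ : _ + _ = N.+1 * (2 * N.+2 * (b + c))); [rewrite !leq_mul2l ubc !orbT | ring].
apply: leq_trans (leq_add (leq_mul (leqnn _) IH) bK) _.
by rewrite (_ : _ + K = N.+1 * (N.+1 * K)) //; ring.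
Qed.

(** At least half of the paths never meet a protected vertex, hence burn.  They
    end in many vertices, since few paths have a common end. *)
Lemma escape_not_containable : ~ containable adj g.
Proof.
have local_ext e T j : j < T -> q e j = q (extend_ffun [ffun i : 'I_T => e i]) j.
  move=> jT; apply: q_local => i ij; rewrite /extend_ffun.
  by rewrite insubT ?(leq_ltn_trans ij jT) // => iT; rewrite ffunE.
pose Z0 : set V := fun v => exists e, v = q e r.
have finZ0 : finite_set Z0.
  pose f (e : {ffun 'I_r.+1 -> bool}) := q (extend_ffun e) r.
  apply: (sub_finite_set _ (finite_image f (@finite_finset _ [set: _]%classic))).
  by move=> _ [e ->]; exists [ffun i : 'I_r.+1 => e i]; rewrite // [RHS](local_ext e r.+1).
move=> /(_ _ finZ0)[S [legal]]; rewrite /contained.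
move=> /finite_seqP[M ZM].
(* [M] lists the burnt vertices; at time [r + N] the paths need more room. *)
have [j0 j0P] := J_unbounded (2 * size M).+1.
pose N := j0.+1; pose T := (r + N).+1.
have /choice[s sP] : forall n, exists s : seq V,
    size s <= \sum_(m < n) g m.+1 /\ forall x, protected S n x -> x \in s.
  by move=> n; have [s ss Ps] := protected_seq n legal; exists s.
pose bad n := [set e : {ffun 'I_T -> bool} | q (extend_ffun e) (r + n.+1) \in s n.+1].
have burn e n : n <= N -> e \notin \bigcup_(k < N) bad k ->
    burning adj Z0 S n (q (extend_ffun e) (r + n)).
  move=> + eP; elim: n => [_|n IH nN]; first by rewrite addn0; exists (extend_ffun e).
  have {}IH := IH (ltnW nN).
  have unprot : ~ protected S n.+1 (q (extend_ffun e) (r + n.+1)).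
    have [_ /[apply] bs] := sP n.+1.
    by move/negP: eP; apply; apply/bigcupP; exists (Ordinal nN); rewrite ?inE.
  rewrite /=; have := q_step (extend_ffun e) (r + n); rewrite -addnS.
  case=> [-> |adjq]; first by left.
  by right; split=> //; exists (q (extend_ffun e) (r + n)).
have badK n : n < N -> #|bad n| * (2 * (n.+1 * n.+2)) <= 2 ^ T.
  move=> nN; have p0 : 0 < 2 ^ size (J (r + n.+1)) by rewrite expn_gt0.
  have rnT : r + n.+1 < T by rewrite ltnS leq_add2l.
  have := card_paths_to (s n.+1) rnT; rewrite -/(bad n).
  have := g_small (ltn0Sn n); have [+ _] := sP n.+1.
  move: p0; move: (2 ^ size _) (2 ^ T) #|bad n| (size (s n.+1)) (\sum_(_ < _) _) (2 * _).
  move=> p K b z G c p0 zG Gc bp; rewrite -(leq_pmul2r p0).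
  apply: (@leq_trans (z * K * c)); first by rewrite mulnAC leq_mul2r bp orbT.
  rewrite mulnAC mulnC leq_mul2l; apply/orP; right.
  apply: leq_trans Gc. by rewrite leq_mul2r zG orbT.
have half_bad : 2 * #|\bigcup_(n < N) bad n| <= 2 ^ T.
  rewrite -(leq_pmul2l (ltn0Sn N)) mulnA [N.+1 * 2]mulnC.
  apply: leq_trans (bad_union_bound badK) _. by rewrite leq_mul2r leqnSn orbT.
have rNT : r + N < T by [].
have few := card_paths_to M rNT.
have good : #|~: \bigcup_(n < N) bad n| <=
    #|[set e : {ffun 'I_T -> bool} | q (extend_ffun e) (r + N) \in M]|.
  apply: subset_leq_card; apply/fintype.subsetP => e; rewrite finset.in_setC => eP.
  rewrite inE; have : [set` M]%classic (q (extend_ffun e) (r + N)).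
    by rewrite -ZM; exists N => //; exact: burn.
  by [].
have many : 2 * size M < 2 ^ size (J (r + N)).
  apply: leq_trans (ltn_expl _ (ltnSn 1)) _; rewrite leq_exp2l // ltnW //.
  by apply: j0P; rewrite -addSnnS leq_addl.
have total : #|\bigcup_(n < N) bad n| + #|~: \bigcup_(n < N) bad n| = 2 ^ T.
  by rewrite cardsC card_ffun card_bool card_ord.
have K0 : 0 < 2 ^ T by rewrite expn_gt0.
move: few half_bad good many total K0.
move: #|\bigcup_(_ < _) _| #|~: _| #|[set _ | _]| (size M) (2 ^ size _) (2 ^ T).
by move=> u v w m p K; nia.
Qed.
End Escape.

(** * A lit path visiting many sites *)

Section LitPath.
Variables (A : groupType) (s : A).
Hypothesis s_neq1 : s <> 1%g.
Local Notation W := (grig_wreath A).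

Fixpoint trail (n : nat) : G012 :=
  if n is m.+1 then (trail m * ga * gbcd (spread_letter m))%g else 1%g.

(** In the coordinates of the start of the walk, lamps do not move, and the lamp
    that can be switched after [n] letters is the one at [site n]. *)
Definition site (n : nat) : orbit_type G012_action ones := orb base (trail n)^-1%g.

Lemma site_back n : sval (site n) = back (mkseq spread_letter n) ones.
Proof.
have actE y : word_act y (val (trail n)^-1%g) = back (mkseq spread_letter n) y.
  elim: n y => [|n IH] y; first by rewrite /= invg1 word_act1.
  rewrite mkseqS -cats1 back_cat -IH [trail n.+1]/= !invgM.
  transitivity (word_act (word_act (word_act y (tree_bcd (spread_letter n))^-1%g)
                                   grig_a^-1%g) (val (trail n)^-1%g)).
    by rewrite -!word_actM.
  by rewrite tree_bcdV grig_aV.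
exact: actE.
Qed.

Definition new (n : nat) : bool :=
  (0 < n) && `[< forall i, 0 < i < n -> site i <> site n >].

Lemma new_site n : 0 < n -> exists m, [/\ m <= n, new m & site m = site n].
Proof.
elim/ltn_ind: n => n IH n0; have [nn|] := boolP (new n); first by exists n.
rewrite /new n0 /= => /asboolPn/existsNP[i /not_implyP[/andP[i0 iltn] /contrapT si]].
have [m [mi nm sm]] := IH i iltn i0; exists m; split=> //; last by rewrite sm.
exact: leq_trans mi (ltnW iltn).
Qed.

Lemma new_inj i j : new i -> new j -> site i = site j -> i = j.
Proof.
move=> /andP[i0 /asboolP ni] /andP[j0 /asboolP nj] sij.
case: (ltngtP i j) => // ij; first by case: (nj i); rewrite ?i0.
by case: (ni j); rewrite ?j0.
Qed.

Fixpoint lit (e : nat -> bool) (n : nat) : W :=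
  if n is m.+1 then
    (lit e m * wlift A ga * wlift A (gbcd (spread_letter m)) *
     if new n && e n then lamp s else 1)%g
  else 1%g.

Definition profile (e : nat -> bool) (n : nat) x : A := wfun (lit e n) (orb x (trail n)).

Lemma profileS e n x :
  profile e n.+1 x =
  (profile e n x *
   if [&& `[< x = site n.+1 >], new n.+1 & e n.+1] then s else 1)%g.
Proof.
rewrite /profile [lit e n.+1]/=; set u := (_ * wlift A ga * _)%g.
have uE : wfun u (orb x (trail n.+1)) = wfun (lit e n) (orb x (trail n)).
  rewrite wfunM wfun_wlift mulg1 wfunM wfun_wlift mulg1 !wtop_wlift -!ractM.
  by rewrite [trail n.+1]/= mulgA !mulgK.
case: (new n.+1 && e n.+1); last by rewrite !mulg1 andbF mulg1.
rewrite andbT -uE wfunM [wtop (lamp s)]/= invg1 ract1; congr (_ * _)%g.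
rewrite /point_fun; congr (if _ then _ else _).
apply/asboolP/asboolP => [e0|->]; last by rewrite /site -ractM mulVg ract1.
by rewrite /site -e0 -ractM mulgV ract1.
Qed.

(** A new site is never met again as a new one, so its lamp keeps the state that
    was chosen at the first visit. *)
Lemma profile_new e n i : new i ->
  profile e n (site i) = if (i <= n) && e i then s else 1%g.
Proof.
move=> ni; elim: n => [|n IH].
  by rewrite leqn0 eqn0Ngt (andP ni).1.
rewrite profileS IH; have [in1|in1] := eqVneq i n.+1.
  rewrite in1 ltnn leqnn /= mul1g -in1 ni.
  by case: asboolP.
rewrite [X in (_ * X)%g]ifN ?mulg1.
  by rewrite [in RHS]leq_eqVlt (negbTE in1).
apply: contra_neqN in1 => /and3P[/asboolP].
by move=> + n1 _; exact: new_inj.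
Qed.

(** Each letter of the walk takes three edges of the Cayley graph: [a], the
    letter itself, and the lamp; the last one may be replaced by a pause. *)
Definition lit_path (e : nat -> bool) (j : nat) : W :=
  (lit e (j %/ 3) *
   match j %% 3 with
   | 0 => 1
   | 1 => wlift A ga
   | _ => wlift A ga * wlift A (gbcd (spread_letter (j %/ 3)))
   end)%g.

Definition news (j : nat) : seq nat := [seq i <- iota 1 (j %/ 3) | new i].

Lemma news_uniq j : uniq (news j).
Proof. exact/filter_uniq/iota_uniq. Qed.

Lemma news_le j i : i \in news j -> i <= j.
Proof.
rewrite mem_filter mem_iota add1n ltnS => /and3P[_ _ /leq_trans]; apply.
exact: leq_div.
Qed.

Lemma lit_path_local e e' j : (forall i, i <= j -> e i = e' i) ->
  lit_path e j = lit_path e' j.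
Proof.
move=> ee'; rewrite /lit_path; congr (_ * _)%g.
have {}ee' i : i <= j %/ 3 -> e i = e' i.
  by move=> ij; apply: ee'; apply: leq_trans ij (leq_div _ _).
elim: (j %/ 3) ee' => //= n IH ee'.
by rewrite IH ?ee' // => i /leqW; exact: ee'.
Qed.

Lemma lit_path_inj e e' j : lit_path e j = lit_path e' j ->
  forall i, i \in news j -> e i = e' i.
Proof.
move=> /mulIg lit_eq i; rewrite mem_filter mem_iota add1n ltnS => /and3P[ni _ ij].
have : profile e (j %/ 3) (site i) = profile e' (j %/ 3) (site i).
  by rewrite /profile lit_eq.
rewrite !profile_new // ij /=.
by case: (e i); case: (e' i) => // /esym.
Qed.

(** Every site met by the walk was new at its first visit. *)
Lemma size_news k j : size (subst_iter k) <= j %/ 3 -> 2 ^ k <= size (news j).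
Proof.
move=> kj; have [I [<- uI /allP aI]] := subst_iter_sites k.
have /choice[f fP] : forall i, exists m, i \in I ->
    [/\ m <= i, new m & site m = site i].
  move=> i; have [/aI/andP[i0 _]|_] := boolP (i \in I); last by exists 0.
  by have [m mP] := new_site i0; exists m.
rewrite -(size_map f); apply: uniq_leq_size; last first.
  move=> _ /mapP[i iI ->]; have [fi nf _] := fP i iI.
  rewrite mem_filter nf mem_iota (andP nf).1 add1n ltnS /=.
  by apply: leq_trans kj; apply: leq_trans fi _; have /andP[] := aI _ iI.
suff : uniq (map (fun m => sval (site m)) (map f I)) by apply: map_uniq.
rewrite -map_comp; congr (is_true (uniq _)): uI; apply/eq_in_map => i iI /=.
have /andP[_ ik] := aI _ iI; rewrite -mkseq_spread_letter //.
have [_ _ sfi] := fP _ iI.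
by rewrite -[RHS]/(sval (site (f i))) sfi site_back.
Qed.

Lemma lit_path_step (adj : W -> W -> Prop) :
  (forall u, adj u (u * wlift A ga)%g) ->
  (forall u v, adj u (u * wlift A (gbcd v))%g) ->
  (forall u, adj u (u * lamp s)%g) ->
  forall e j, lit_path e j.+1 = lit_path e j \/ adj (lit_path e j) (lit_path e j.+1).
Proof.
move=> adja adjv adjs e j; rewrite /lit_path (divn_eq j 3).
have : j %% 3 < 3 by rewrite ltn_mod.
move: (j %/ 3) (j %% 3) => n [|[|[|//]]] _.
- right; rewrite -addnS !divnMDl ?modnMDl //= addn0 mulg1.
  exact: adja.
- right; rewrite -addnS !divnMDl ?modnMDl //= addn0 mulgA.
  exact: adjv.
- rewrite -addnS !divnMDl ?modnMDl //= ?addn0 addn1 mulg1 mulgA /=.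
  case: ifP => _; [right | by left; rewrite mulg1].
  exact: adjs.
Qed.
End LitPath.

(** * The fire escapes when firefighters are too slow *)

Lemma cayley_adj_gen (G : groupType) (S : set G) u s :
  S s -> cayley_adj S u (u * s)%g.
Proof. by move=> Ss; exists s => //; left. Qed.

Lemma grig_wreath_gens_wlift (A : finGroupType) (SA : {set A}) (g : G012) :
  val g \in grig_gens -> grig_wreath_gens SA (wlift A g).
Proof. by move=> gg; right; exists g. Qed.

Lemma grig_wreath_not_containable (A : finGroupType) (SA : {set A}) s g r :
  s \in SA -> s <> 1%g ->
  (forall n, 0 < n ->
    (\sum_(m < n) g m.+1) * (2 * (n * n.+1)) <= 2 ^ size (news (r + n))) ->
  ~ containable (cayley_adj (grig_wreath_gens SA)) g.
Proof.
move=> sSA s1 small.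
apply: (@escape_not_containable _ _ _ (lit_path s) news r) => //.
- apply: lit_path_step => *; apply: cayley_adj_gen.
  + by apply: grig_wreath_gens_wlift; exact: grig_a_gen.
  + by apply: grig_wreath_gens_wlift; exact: tree_bcd_gen.
  + by left; exists s.
- exact: lit_path_local.
- exact: lit_path_inj.
- exact: news_uniq.
- exact: news_le.
- move=> m; exists (3 * size (subst_iter m)) => j mj.
  apply: leq_trans (ltnW (ltn_expl m (ltnSn 1))) _.
  by apply: size_news; rewrite leq_divRL // mulnC.
Qed.

(** * The growth exponent *)

Local Open Scope ring_scope.

Section Exponent.
Variables (R : realType) (eta : R).
Hypothesis eta_root : root ('X^3 + 'X^2 + 'X - 2%:P) eta.

Lemma eta_eq : eta ^+ 3 + eta ^+ 2 + eta = 2.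
Proof.
move: eta_root; rewrite /root !hornerE => /eqP e.
by apply/eqP; rewrite -subr_eq0; apply/eqP; rewrite -[RHS]e.
Qed.

Lemma eta_gt0 : 0 < eta.
Proof.
rewrite ltNge; apply/negP => e0; have := eta_eq.
rewrite (_ : _ + _ = eta * (eta ^+ 2 + eta + 1)); last by ring.
have : 0 < eta ^+ 2 + eta + 1 by nra.
by move=> h1 h2; nra.
Qed.

Lemma eta_lt1 : eta < 1.
Proof.
rewrite ltNge; apply/negP => e1; have := eta_eq.
have e2 : 1 <= eta ^+ 2 by rewrite exprn_ege1.
have e3 : 1 <= eta ^+ 3 by rewrite exprn_ege1.
by move=> h; lra.
Qed.

Definition alpha : R := ln 2 / ln (2 / eta).

Lemma ratio_gt2 : 2 < 2 / eta.
Proof. by rewrite ltr_pdivlMr ?eta_gt0 //; have := eta_lt1; lra. Qed.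

Lemma ln2_gt0 : 0 < ln 2 :> R.
Proof. by rewrite ln_gt0 //; lra. Qed.

Lemma ln2_lt_ln_ratio : ln 2 < ln (2 / eta).
Proof. by have r2 := ratio_gt2; rewrite ltr_ln ?posrE; lra. Qed.

Lemma alpha_gt0 : 0 < alpha.
Proof. by have := ln2_gt0; have := ln2_lt_ln_ratio => h1 h2; rewrite divr_gt0 //; lra. Qed.

Lemma ratio_alpha : (2 / eta) `^ alpha = 2.
Proof.
have := ln2_gt0; have := ln2_lt_ln_ratio; have := ratio_gt2 => h0 h1 h2.
have r0 : 0 < 2 / eta by lra.
rewrite -[X in X `^ _]lnK ?posrE // -expRM mulrC /alpha divfK ?lnK ?posrE //.
by lra.
Qed.

(** The weight of the syllable [a v] in the norm that the decomposition into
    halves contracts by [eta]. *)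
Definition syllable_weight (v : bcd) : R :=
  match v with Lb => 1 | Lc => eta | Ld => eta ^+ 2 end.

(** The vector of the weights of the syllables is an eigenvector of the matrix of
    the substitution; for [Lb] this is the equation of [eta]. *)
Lemma sum_weight_subst w :
  \sum_(v <- subst w) syllable_weight v = 2 / eta * \sum_(v <- w) syllable_weight v.
Proof.
have e0 : eta != 0 by have := eta_gt0; lra.
elim: w => [|v w IH]; first by rewrite !big_nil mulr0.
rewrite [subst _]/= /subst big_cat -/(subst w) IH big_cons mulrDr; congr (_ + _).
have ee := eta_eq.
case: v => /=; rewrite !big_cons big_nil /=; last 2 first.
- by rewrite divfK ?addr0 // (_ : 1 + 1 = 2).
- by rewrite expr2 mulrA divfK //; ring.
by rewrite -[X in X / eta]ee; field.
Qed.

(** Each syllable weighs at least [eta ^+ 2]. *)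
Lemma size_subst_iter_le k : (size (subst_iter k))%:R * eta ^+ 2 <= (2 / eta) ^+ k.
Proof.
have -> : (2 / eta) ^+ k = \sum_(v <- subst_iter k) syllable_weight v.
  elim: k => [|k IH]; first by rewrite big_seq1.
  by rewrite exprS IH /= sum_weight_subst.
have e0 := eta_gt0; have e1 := eta_lt1.
elim: (subst_iter k) => [|v w IH]; first by rewrite big_nil mul0r.
rewrite big_cons /= -natr1 mulrDl mul1r addrC lerD //.
by case: v => /=; rewrite ?lexx //; nra.
Qed.

Lemma powR_eventually_le (K c p p' : R) : 0 < c -> p < p' ->
  exists N : nat, forall n : nat, (N <= n)%N -> K * n%:R `^ p <= c * n%:R `^ p'.
Proof.
move=> c0 pp'; pose d := p' - p; have d0 : 0 < d by rewrite subr_gt0.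
pose M := (`|K| / c) `^ d^-1.
exists (Num.truncn M).+1 => n Mn.
have n0 : 0 < n%:R :> R by rewrite ltr0n (leq_trans _ Mn).
have Mlt : M <= n%:R.
  by apply: ltW; apply: lt_le_trans (truncnS_gt M) _; rewrite ler_nat.
rewrite -[p'](subrK p) powRD; last by rewrite (gt_eqF n0) implybT.
rewrite mulrA ler_wpM2r ?powR_ge0 //.
apply: le_trans (ler_norm K) _; rewrite mulrC -ler_pdivrMr //.
have Kc : 0 <= `|K| / c by rewrite divr_ge0 // ltW.
have -> : `|K| / c = M `^ d by rewrite /M -powRrM mulVf ?gt_eqF // powRr1.
by apply: ge0_ler_powR; rewrite ?nnegrE ?powR_ge0 ?ler0n ?(ltW d0).
Qed.

Lemma news_growth :
  exists2 c : R, 0 < c & forall j, (3 <= j)%N -> c * j%:R `^ alpha <= (size (news j))%:R.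
Proof.
have e0 := eta_gt0; have a0 := alpha_gt0.
pose c : R := 2^-1 * (eta ^+ 2 / 6) `^ alpha.
exists c => [|j j3]; first by rewrite mulr_gt0 ?powR_gt0 ?divr_gt0 ?exprn_gt0 //; lra.
pose n := (j %/ 3)%N.
have n0 : (0 < n)%N by rewrite divn_gt0.
have exP : exists k, (size (subst_iter k) <= n)%N by exists 0%N.
have bP k : (size (subst_iter k) <= n)%N -> (k <= n)%N.
  by move=> kn; apply: ltnW; apply: leq_trans (ltn_expl k (ltnSn 1)) (leq_trans (size_subst_iter k) kn).
(* The last iterate that the walk has completed after [n] letters. *)
case: (ex_maxnP exP bP) => k kn kmax.
have nk : (n < size (subst_iter k.+1))%N.
  by rewrite ltnNge; apply/negP => /kmax; rewrite ltnn.
have -> : c * j%:R `^ alpha = 2^-1 * (eta ^+ 2 / 6 * j%:R) `^ alpha.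
  by rewrite powRM ?mulrA // divr_ge0 ?exprn_ge0 // ltW.
apply: (@le_trans _ _ (2 ^+ k)); last first.
  by rewrite -natrX ler_nat; apply: size_news.
rewrite -ler_pdivlMl ?invr_gt0 // invrK -exprS.
have -> : 2 ^+ k.+1 = ((2 / eta) ^+ k.+1) `^ alpha.
  have r0 : 0 <= 2 / eta by have := ratio_gt2; lra.
  by rewrite -[in LHS]ratio_alpha -!powR_mulrn ?powR_ge0 // -!powRrM [alpha * _]mulrC.
apply: ge0_ler_powR; rewrite ?nnegrE ?(ltW a0) //.
- by rewrite mulr_ge0 // divr_ge0 ?exprn_ge0 // ltW.
- by rewrite exprn_ge0 //; have := ratio_gt2; lra.
apply: le_trans (size_subst_iter_le k.+1).
have jn : (j <= 6 * n)%N by rewrite /n; lia.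
have : j%:R <= 6 * (size (subst_iter k.+1))%:R :> R.
  rewrite -natrM ler_nat; apply: leq_trans jn _; rewrite leq_mul2l //.
  exact: ltnW.
have : 0 < eta ^+ 2 by rewrite exprn_gt0.
move: (eta ^+ 2) (j%:R : R) ((size _)%:R : R) => x y z; nra.
Qed.

(** Shifting the time by [r] lets [(r + n) ^ alpha] beat [(r + n) ^ gamma] for
    all [n] at once; polynomial factors are absorbed by [expR (m ^ gamma)], since
    [ln m <= m ^ gamma / gamma]. *)
Lemma slow_firefighters (gamma C : R) (g : nat -> nat) :
  0 < gamma -> gamma < alpha -> 0 < C ->
  (forall n, (0 < n)%N -> (g n)%:R <= C * expR (n%:R `^ gamma)) ->
  exists r, forall n, (0 < n)%N ->
    ((\sum_(m < n) g m.+1) * (2 * (n * n.+1)) <= 2 ^ size (news (r + n)))%N.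
Proof.
move=> g0 ga C0 gC; have [c c0 cP] := news_growth.
have l2 := ln2_gt0.
pose K := 1 + 3 / gamma + 4 * C.
have [N NP] := powR_eventually_le K (mulr_gt0 l2 c0) ga.
exists (maxn N 3) => n n0; set m := (maxn N 3 + n)%N.
have nm : (n <= m)%N by rewrite leq_addl.
have m1 : 1 <= m%:R :> R by rewrite ler1n; lia.
have m0 : 0 < m%:R :> R by lra.
have mg1 : 1 <= m%:R `^ gamma :> R.
  have : 1 `^ gamma <= m%:R `^ gamma.
    by apply: ge0_ler_powR; rewrite ?nnegrE ?ler0n ?(ltW g0).
  by rewrite powR1.
have m_exp : m%:R <= expR (m%:R `^ gamma / gamma).
  rewrite -[leLHS]lnK ?posrE // ler_expR ler_pdivlMr // mulrC -ln_powR.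
  by apply: ltW; apply: ln_sublinear; lra.
have sum_le : (\sum_(i < n) g i.+1)%:R <= m%:R * (C * expR (m%:R `^ gamma)).
  rewrite natr_sum; apply: (@le_trans _ _ (\sum_(i < n) C * expR (m%:R `^ gamma))).
    apply: ler_sum => i _; apply: le_trans (gC i.+1 isT) _.
    rewrite ler_pM2l // ler_expR ge0_ler_powR ?nnegrE ?(ltW g0) //.
    by rewrite ler_nat; apply: leq_trans nm; exact: ltn_ord.
  rewrite sumr_const card_ord -[leLHS]mulr_natl ler_wpM2r ?ler_nat //.
  by rewrite mulr_ge0 ?expR_ge0 // ltW.
rewrite -(ler_nat R) natrM.
apply: (@le_trans _ _ (expR (K * m%:R `^ gamma))); last first.
  rewrite natrX -[X in _ <= X ^+ _]lnK ?posrE // -expRM_natl ler_expR.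
  apply: le_trans (NP m _) _; first by rewrite /m; lia.
  by rewrite -mulrA mulrC ler_wpM2r ?(ltW l2) // cP // /m; lia.
have poly_le : (2 * (n * n.+1))%:R <= 4 * (m%:R * m%:R) :> R.
  by rewrite -!natrM ler_nat; nia.
apply: (le_trans (ler_pM _ _ sum_le poly_le)); rewrite ?ler0n //.
have C_exp : 4 * C <= expR (4 * C * m%:R `^ gamma).
  apply: (@le_trans _ _ (expR (4 * C))).
    by apply: le_trans (expR_ge1Dx _); lra.
  by rewrite ler_expR; nra.
have -> : K * m%:R `^ gamma = m%:R `^ gamma + m%:R `^ gamma / gamma +
    m%:R `^ gamma / gamma + m%:R `^ gamma / gamma + 4 * C * m%:R `^ gamma.
  by rewrite /K; field; lra.
rewrite !expRD.
move: m_exp C_exp (expR_ge0 (m%:R `^ gamma)).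
move: (expR (m%:R `^ gamma)) (expR (m%:R `^ gamma / gamma)) (expR (4 * C * _)).
move=> x y z my Cz x0.
have -> : m%:R * (C * x) * (4 * (m%:R * m%:R)) = x * m%:R * m%:R * m%:R * (4 * C) by ring.
have m0' := ltW m0; apply: ler_pM => //; [by rewrite !mulr_ge0 | by lra | ].
by do 2![apply: ler_pM => //; first by rewrite ?mulr_ge0]; apply: ler_pM.
Qed.
End Exponent.

(** * Words of small weight have few values *)

Section Weights.
Variables (R : realType) (eta : R).
Hypothesis eta_root : root ('X^3 + 'X^2 + 'X - 2%:P) eta.

(** Requiring that the decomposition into halves contracts [a b], [a c] and [a d]
    by a common factor [eta], and that the weight of [b = c d] be the sum of those
    of [c] and [d], determines the weights up to scaling and leads to the equation
    of [eta]. *)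
Definition weight_a : R := 1 - eta ^+ 3.
Definition weight (v : bcd) : R :=
  match v with Lb => eta ^+ 3 | Lc => 1 - eta ^+ 2 | Ld => 1 - eta end.
Definition weight_half0 (v : bcd) : R := if v == Ld then 0 else weight_a.

Lemma eta_bounds : [/\ 0 < eta, eta < 1, 0 <= eta ^+ 3, eta ^+ 2 <= eta &
  eta ^+ 3 <= eta ^+ 2].
Proof.
have e0 := eta_gt0 eta_root; have e1 := eta_lt1 eta_root; split=> //.
- by rewrite exprn_ge0 // ltW.
- by rewrite expr2 ler_piMr // ltW.
- by rewrite exprS ler_piMl ?exprn_ge0 // ltW.
Qed.

Lemma weight_a_bounds : 1 - eta <= weight_a <= 1.
Proof.
have [e0 e1 e30 e21 e32] := eta_bounds.
by rewrite /weight_a; apply/andP; split; lra.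
Qed.

Lemma weight_bounds v : 1 - eta <= weight v <= 1.
Proof.
have [e0 e1 e30 e21 e32] := eta_bounds.
have ee := eta_eq eta_root.
by apply/andP; case: v; split=> /=; lra.
Qed.

(** The triangle inequality for the weights: merging two letters of [bcd] does
    not increase the weight. *)
Lemma weight_third u v : u != v -> weight (bcd_third u v) <= weight u + weight v.
Proof.
have [e0 e1 e30 e21 e32] := eta_bounds; have ee := eta_eq eta_root.
by case: u; case: v => //= _; lra.
Qed.

(** On the left is what the letter [v] contributes to the two halves. *)
Lemma weight_halves v :
  weight_half0 v + weight (bcd_succ v) = eta * (weight_a + weight v).
Proof.
have ee := eta_eq eta_root.
have e4 : eta * (eta ^+ 3 + eta ^+ 2 + eta) = eta * 2 by rewrite ee.
by case: v; rewrite /weight_half0 /= /weight_a; lra.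
Qed.

Variable A : finGroupType.
Local Notation W := (grig_wreath A).
Local Notation a := (wlift A ga).
Local Notation l v := (wlift A (gbcd v)).

(** Lamps are free because the decomposition into halves hands them over without
    making them shorter. *)
Inductive word : R -> W -> Prop :=
| word1 : word 0 1%g
| word_lamp t x s of word t x : word t (x * lamp s)%g
| word_a t x of word t x : word (t + weight_a) (x * a)%g
| word_bcd t x v of word t x : word (t + weight v) (x * l v)%g.

(** Words in which an [a] separates any two letters of [bcd], so that each letter
    but one can be paired with an [a] as in [weight_halves].  The flag tells
    whether an [a] follows the last letter of [bcd]; it is also set when there
    is no such letter. *)
Inductive reduced : bool -> R -> W -> Prop :=
| reduced1 : reduced true 0 1%g
| reduced_lamp f t x s of reduced f t x : reduced f t (x * lamp s)%g
| reduced_a f t x of reduced f t x : reduced true (t + weight_a) (x * a)%g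
| reduced_bcd t x v of reduced true t x : reduced false (t + weight v) (x * l v)%g.

Lemma wlift1 : wlift A 1%g = 1%g.
Proof. by apply: wreath_eq. Qed.

Lemma wliftM g h : (wlift A g * wlift A h = wlift A (g * h))%g.
Proof. by apply: wreath_eq => //; apply/funext => x; rewrite wfunM !wfun_wlift mulg1. Qed.

Lemma gbcd_mul u v :
  (gbcd u * gbcd v = if u == v then 1 else gbcd (bcd_third u v))%g.
Proof.
by apply/val_inj; rewrite [LHS](tree_bcd_mul u v); case: eqP.
Qed.

Lemma lamp1 : lamp (1 : A)%g = 1%g.
Proof. by apply: wreath_eq => //; apply/funext => x /=; rewrite /point_fun if_same. Qed.

Lemma lampM (s s' : A) : (lamp s * lamp s' = lamp (s * s'))%g.
Proof.
apply: wreath_eq => [|]; last by rewrite /= mulg1.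
apply/funext => x; rewrite wfunM [wtop (lamp s')]/= invg1 ract1 /= /point_fun.
by case: asboolP; rewrite ?mulg1.
Qed.

(** The letters of [bcd] fix the word [ones], where the lamp is switched. *)
Lemma lamp_bcd (s : A) v : (lamp s * l v = l v * lamp s)%g.
Proof.
have fixv : orb base (gbcd v) = base.
  by apply: eq_sig_hprop => [?|]; [exact: Prop_irrelevance | exact: act_ones].
apply: wreath_eq => [|]; last by rewrite /= mulg1 mul1g.
apply/funext => x; rewrite !wfunM wtop_wlift !wfun_wlift mul1g mulg1 /point_fun.
congr (if _ then _ else _); apply/asboolP/asboolP => [xv|->].
  by rewrite -fixv -xv -ractM mulVg ract1.
by rewrite -[in LHS]fixv -ractM mulgV ract1.
Qed.

Lemma reduced_last t x : reduced false t x ->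
  exists y u v s, [/\ reduced true u y, t = u + weight v & x = (y * l v * lamp s)%g].
Proof.
move Ef : false => f h; elim: h Ef => {f t x} // [f t x s _ IH /IH|t x v xr _ _].
  move=> [y [u [v [s' [yr -> ->]]]]]; exists y, u, v, (s' * s)%g.
  by split=> //; rewrite -!mulgA lampM.
by exists x, t, v, 1%g; rewrite lamp1 mulg1.
Qed.

(** A letter of [bcd] commutes with the lamps that separate it from the previous
    one, with which it merges. *)
Lemma word_reduced t x : word t x -> exists f u, u <= t /\ reduced f u x.
Proof.
elim=> {t x} [|t x s _ [f [u [ut xr]]]|t x _ [f [u [ut xr]]]|t x v _ [[] [u [ut xr]]]].
- by exists true, 0; split=> //; exact: reduced1.
- by exists f, u; split=> //; exact: reduced_lamp.
- by exists true, (u + weight_a); rewrite lerD2r; split=> //; exact: reduced_a xr.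
- by exists false, (u + weight v); rewrite lerD2r; split=> //; exact: reduced_bcd.
have [y [w [v' [s [yr uE xE]]]]] := reduced_last xr.
have {xE} -> : (x * l v = y * (l v' * l v) * lamp s)%g.
  by rewrite xE -!mulgA lamp_bcd.
rewrite wliftM gbcd_mul; have [e0 e1 _ _ _] := eta_bounds.
have /andP[wv _] := weight_bounds v; have /andP[wv' _] := weight_bounds v'.
have [_|/weight_third v3] := eqVneq v' v.
  exists true, w; rewrite wlift1 mulg1; split; last exact: reduced_lamp.
  by lra.
exists false, (w + weight (bcd_third v' v)); split; first by lra.
exact/reduced_lamp/reduced_bcd.
Qed.

(** By [weight_halves] a letter of [bcd] borrows the weight of an [a]; the next
    [a], which only exchanges the halves, repays it.  The debt of the last letter
    may remain. *)
Lemma reduced_halves f t x : reduced f t x ->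
  exists sigma z w, [/\ halves x sigma z, forall i, word (w i) (z i) &
    w false + w true <= eta * (t + if f then 0 else weight_a)].
Proof.
have [e0 e1 _ _ _] := eta_bounds.
have /andP[wa wa1] := weight_a_bounds.
elim=> {f t x} [|f t x s _ [sigma [z [w [hx wz wle]]]]
  |f t x _ [sigma [z [w [hx wz wle]]]]|t x v _ [sigma [z [w [hx wz wle]]]]].
- exists false, (fun=> 1%g), (fun=> 0); split; [exact: halves1 | by move=> _; exact: word1 |].
  by lra.
- exists (sigma (+) false), (fun i => z i * if i (+) sigma then lamp s else 1)%g, w.
  split=> //; first exact: halvesM hx (halves_lamp s).
  by move=> i; case: ifP => _; rewrite ?mulg1 //; exact: word_lamp.
- exists (sigma (+) true), (fun i => z i * 1)%g, w.
  split; [exact: halvesM hx (halves_a A) | by move=> i; rewrite mulg1 |].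
  by apply: le_trans wle _; case: f; nra.
exists (sigma (+) false),
  (fun i => z i * if i (+) sigma then l (bcd_succ v) else half0 A v)%g,
  (fun i => w i + if i (+) sigma then weight (bcd_succ v) else weight_half0 v).
split; first exact: halvesM hx (halves_bcd A v).
  move=> i; case: ifP => _; first exact: word_bcd.
  rewrite /half0 /weight_half0; case: ifP => _; first by rewrite mulg1 addr0.
  exact: word_a.
by have := weight_halves v; case: sigma {hx} => /=; nra.
Qed.

Lemma word_ge0 t x : word t x -> 0 <= t.
Proof.
have [e0 e1 _ _ _] := eta_bounds.
have /andP[wa wa1] := weight_a_bounds.
by elim=> // {}t {}x; [lra | move=> v _; have /andP[] := weight_bounds v; lra].
Qed.

Lemma word_halves t x : word t x ->
  exists sigma z w, [/\ halves x sigma z, forall i, word (w i) (z i) &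
    w false + w true <= eta * (t + 1)].
Proof.
have [e0 e1 _ _ _] := eta_bounds.
have /andP[wa wa1] := weight_a_bounds.
move=> /word_reduced[f [u [ut /reduced_halves[sigma [z [w [hx wz wle]]]]]]].
by exists sigma, z, w; split=> //; apply: le_trans wle _; case: f; nra.
Qed.

(** Weight 0 allows arbitrarily many lamps, but consecutive lamps merge: the words
    with [n] other letters have finitely many values. *)
Fixpoint n_letter_words (n : nat) : set W :=
  if n is m.+1 then
    (\bigcup_(g in [set a; l Lb; l Lc; l Ld])
       \bigcup_(s in [set: A]) [set x * g * lamp s | x in n_letter_words m]%g)%classic
  else [set lamp s | s in [set: A]]%classic.

Lemma finite_n_letter_words n : finite_set (n_letter_words n).
Proof.
elim: n => [|n IH] /=; first exact: finite_image.
apply: bigcup_finite => [|g _]; first by rewrite !finite_setU.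
by apply: bigcup_finite => // s _; exact: finite_image.
Qed.

Lemma n_letter_words_lamp n x s : n_letter_words n x -> n_letter_words n (x * lamp s)%g.
Proof.
case: n => [[s' _ <-]|n [g gg [s' _ [y yn <-]]]].
  by exists (s' * s)%g; rewrite ?lampM.
by exists g => //; exists (s' * s)%g => //; exists y; rewrite // -[RHS]mulgA lampM.
Qed.

Lemma word_n_letters t x : word t x ->
  exists2 n, n%:R * (1 - eta) <= t & n_letter_words n x.
Proof.
have [e0 e1 _ _ _] := eta_bounds.
have letter n (g y : W) : [set a; l Lb; l Lc; l Ld]%classic g -> n_letter_words n y ->
    n_letter_words n.+1 (y * g)%g.
  by move=> gg yn; exists g => //; exists 1%g => //; exists y; rewrite // lamp1 mulg1.
have /andP[wa wa1] := weight_a_bounds.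
elim=> {t x} [|t x s _ [n nt xn]|t x _ [n nt xn]|t x v _ [n nt xn]].
- by exists 0%N; [rewrite mul0r | exists 1%g; rewrite ?lamp1].
- by exists n => //; exact: n_letter_words_lamp.
- exists n.+1; first by rewrite -natr1 mulrDl mul1r; lra.
  by apply: letter => //; do 3 left.
- exists n.+1; first by rewrite -natr1 mulrDl mul1r; have /andP[] := weight_bounds v; lra.
  apply: letter => //; case: v; [by left; left; right | by left; right | by right].
Qed.

Lemma finite_words T : finite_set [set x | exists2 t, t <= T & word t x]%classic.
Proof.
have [e0 e1 _ _ _] := eta_bounds; have d0 : 0 < 1 - eta by lra.
pose N := (Num.truncn (T / (1 - eta))).+1.
apply: (@sub_finite_set _ _ (\bigcup_(n in `I_N) n_letter_words n)%classic); last first.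
  by apply: bigcup_finite => // n _; exact: finite_n_letter_words.
move=> x [t tT /word_n_letters[n nt xn]]; exists n => //=.
rewrite -(ltr_nat R); apply: le_lt_trans (truncnS_gt _).
by rewrite ler_pdivlMr //; lra.
Qed.
End Weights.

(** * Short codes for the elements of balls *)

Section Codes.
Variables (A : groupType) (leaves : seq (grig_wreath A)).
Local Notation W := (grig_wreath A).

Definition join_halves (sigma : bool) (z : bool -> W) : W :=
  xget 1%g [set x | halves x sigma z]%classic.

Lemma join_halvesE x sigma z : halves x sigma z -> join_halves sigma z = x.
Proof.
by move=> hx; apply: xget_unique => // y hy; exact: halves_unique hy hx.
Qed.

Definition symbol : finType := option ('I_(size leaves) + bool)%type.

(** A tree of halves is written in reverse Polish notation, so that no separators
    are needed and a code of length [m] is just a word of length [m]; the symbol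
    [None] is a padding that makes all lengths equal. *)
Definition read (st : seq W) (c : symbol) : seq W :=
  match c with
  | None => st
  | Some (inl i) => nth 1%g leaves i :: st
  | Some (inr sigma) =>
      if st is y :: x :: st' then join_halves sigma (fun i => if i then y else x) :: st'
      else st
  end.

Definition codes (c : seq symbol) (x : W) : Prop :=
  forall st, foldl read st c = x :: st.

Lemma codes_leaf x : x \in leaves -> exists c, codes [:: c] x.
Proof.
move=> xl; have il : (index x leaves < size leaves)%N by rewrite index_mem.
by exists (Some (inl (Ordinal il))) => st; rewrite /= nth_index.
Qed.

Lemma codes_join x sigma z c0 c1 : halves x sigma z ->
  codes c0 (z false) -> codes c1 (z true) ->
  codes (rcons (c0 ++ c1) (Some (inr sigma))) x.
Proof.
move=> hx h0 h1 st; rewrite foldl_rcons foldl_cat h0 h1 /=; congr (_ :: _).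
apply: join_halvesE; rewrite (_ : (fun _ => _) = z) //.
by apply/funext => -[].
Qed.

Lemma codes_pad c x m : (size c <= m)%N -> codes c x ->
  exists t : m.-tuple symbol, codes t x.
Proof.
move=> cm cx; have sz : size (c ++ nseq (m - size c) None) == m.
  by rewrite size_cat size_nseq subnKC.
exists (Tuple sz) => st /=; rewrite foldl_cat cx.
by elim: (m - _)%N => /=.
Qed.
End Codes.

Section Growth.
Variables (R : realType) (eta : R).
Hypothesis eta_root : root ('X^3 + 'X^2 + 'X - 2%:P) eta.

(** Both terms are bounded by the tangent to the power at the mean; the tangent
    inequality is Young's inequality for the exponents [1 / p] and
    [1 / (1 - p)]. *)
Lemma powR_concave (x y p : R) : 0 <= x -> 0 <= y -> 0 < p -> p < 1 ->
  x `^ p + y `^ p <= 2 * ((x + y) / 2) `^ p.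
Proof.
move=> x0 y0 p0 p1; have bern u : 0 <= u -> u `^ p <= u * p + (1 - p).
  move=> u0; have := @conjugate_powR _ (u `^ p) 1 p^-1 (1 - p)^-1.
  rewrite mulr1 -powRrM mulfV ?gt_eqF // powRr1 // powR1 mul1r !invrK.
  apply; rewrite ?powR_ge0 ?invr_gt0 ?subr_gt0 //; lra.
have [m0|m0] := leP ((x + y) / 2) 0.
  have [-> ->] : x = 0 /\ y = 0 by split; lra.
  by rewrite addr0 mul0r powR0 ?gt_eqF // mulr0 addr0.
set m := (x + y) / 2 in m0 *.
have scale u : 0 <= u -> u `^ p <= m `^ p * (u / m * p + (1 - p)).
  move=> u0; have m0' := ltW m0; have um : 0 <= u / m by rewrite divr_ge0.
  rewrite -[in leLHS](divfK (lt0r_neq0 m0) u) mulrC powRM //.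
  by apply: ler_wpM2l; rewrite ?powR_ge0 // bern.
apply: le_trans (lerD (scale _ x0) (scale _ y0)) _.
rewrite -mulrDr mulrC ler_wpM2r ?powR_ge0 //.
rewrite (_ : _ + _ = (x + y) / m * p + 2 * (1 - p)); last by field; exact: lt0r_neq0.
have -> : x + y = 2 * m by rewrite /m; field.
by rewrite mulfK ?gt_eqF //; lra.
Qed.

(** By concavity the last bound reduces to [2 ^ (1 / p) * (eta * (t + 1) + 2) / 2
    <= t + 1].  Since [p > alpha] means [2 ^ (1 / p) < 2 / eta], it holds for
    large [t]. *)
Lemma halves_budget (p : R) : alpha eta < p -> p < 1 ->
  exists T, forall t u v, T <= t -> 0 <= u -> 0 <= v -> u + v <= eta * (t + 1) ->
    [/\ u <= t - 1, v <= t - 1 &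
        2 * (u + 1) `^ p + 2 * (v + 1) `^ p <= 2 * (t + 1) `^ p].
Proof.
move=> ap p1; have e0 := eta_gt0 eta_root; have e1 := eta_lt1 eta_root.
have p0 : 0 < p by apply: lt_trans ap; exact: alpha_gt0.
pose k : R := 2 `^ p^-1.
have k0 : 0 < k by rewrite powR_gt0.
have kp : k `^ p = 2 by rewrite -powRrM mulVf ?gt_eqF // powRr1.
have kr : k < 2 / eta.
  have r2 := ratio_gt2 eta_root; have r0 : 0 < 2 / eta by lra.
  rewrite -ltr_ln ?posrE // ln_powR mulrC ltr_pdivrMr // mulrC.
  rewrite -ltr_pdivrMr //; apply: lt_trans (ln2_lt_ln_ratio eta_root).
  exact: ln2_gt0.
have ke : k * eta < 2 by rewrite -ltr_pdivlMr.
pose d := 1 - k * eta / 2; have d0 : 0 < d by rewrite /d; lra.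
exists (Num.max ((1 + eta) / (1 - eta)) (k / d)) => t u v.
rewrite ge_max ler_pdivrMr; last lra.
rewrite ler_pdivrMr // => /andP[t1 t2] u0 v0 uv.
split; try by nra.
rewrite -mulrDr ler_wpM2l //.
apply: le_trans (powR_concave _ _ p0 p1) _; try by lra.
rewrite -[X in X * _]kp -powRM; [|by lra|by lra].
have t0 : 0 <= t by nra.
apply: ge0_ler_powR; rewrite ?nnegrE ?(ltW p0) //; try by [lra|rewrite mulr_ge0 //; lra].
have kuv : k * (u + v) <= k * (eta * (t + 1)) by rewrite ler_pM2l.
by move: t2; rewrite /d; lra.
Qed.

Variable A : finGroupType.
Local Notation W := (grig_wreath A).

(** The elements of weight below the threshold of [halves_budget] serve as leaves;
    each half of a larger element weighs less by 1 at least, which allows an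
    induction. *)
Lemma short_codes (p : R) : alpha eta < p -> p < 1 ->
  exists leaves : seq W, forall t x, word eta t x ->
    exists2 c : seq (symbol leaves), (size c)%:R <= 2 * (t + 1) `^ p & codes c x.
Proof.
move=> ap p1; have p0 : 0 < p by apply: lt_trans ap; exact: alpha_gt0.
have [T TP] := halves_budget ap p1.
have [L LE] := (finite_seqP _).1 (finite_words eta_root A T).
exists L => t x wx.
(* The term [- 1] pays for the symbol that joins two codes. *)
suff [c cs cx] : exists2 c : seq (symbol L), (size c)%:R <= 2 * (t + 1) `^ p - 1 & codes c x.
  by exists c => //; apply: le_trans cs _; lra.
move: (Num.truncn t).+1 (truncnS_gt t) => N.
elim: N t x wx => [|n IH] t x wx tn.
  by have := word_ge0 eta_root wx; lra.
have t0 := word_ge0 eta_root wx.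
have [tT|/ltW Tt] := leP t T.
  have xL : x \in L by have : [set` L]%classic x by rewrite -LE; exists t.
  have [c cx] := codes_leaf xL; exists [:: c] => //=.
  have : 1 `^ p <= (t + 1) `^ p.
    by apply: ge0_ler_powR; rewrite ?nnegrE ?(ltW p0) //; lra.
  by rewrite powR1; lra.
have [sigma [z [w [hx wz wle]]]] := word_halves eta_root wx.
have w0 i : 0 <= w i by exact: word_ge0 (wz i).
have [w0t w1t fit] := TP _ _ _ Tt (w0 false) (w0 true) wle.
have wn i : w i < n%:R by move: tn; rewrite -natr1; case: i; lra.
have [c0 s0 h0] := IH _ _ (wz false) (wn false).
have [c1 s1 h1] := IH _ _ (wz true) (wn true).
exists (rcons (c0 ++ c1) (Some (inr sigma))); last exact: codes_join hx h0 h1.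
by rewrite size_rcons size_cat -natr1 natrD; lra.
Qed.
End Growth.

(** * Containment by a sphere *)

Lemma card_seq_le (V : eqType) (s : seq V) : ([set` s] #<= `I_(size s))%card.
Proof.
case: s => [|x s]; first by rewrite (_ : [set` _]%classic = set0%classic) ?card_ge0 //; apply/seteqP; split.
apply: card_le_trans (card_image_le (nth x (x :: s)) `I_(size (x :: s))%classic).
apply: subset_card_le => y /= yx; exists (index y (x :: s)); last exact: nth_index.
by have : (index y (x :: s) < size (x :: s))%N by rewrite index_mem.
Qed.

Section Sphere.
Local Open Scope classical_set_scope.
Variables (V : Type) (adj : V -> V -> Prop).

Definition free_fire (Z0 : set V) : nat -> set V := burning adj Z0 (fun=> set0).

Lemma free_protected n : protected (fun=> set0) n = set0 :> set V.
Proof. by elim: n => //= n ->; rewrite setU0. Qed.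

Lemma burningS Z0 S n : burning adj Z0 S n.+1 =
  burning adj Z0 S n `|`
    [set v | ~ protected S n.+1 v /\ exists2 u, burning adj Z0 S n u & adj u v].
Proof. by []. Qed.

(** All the vertices that the fire would reach at round [n + 1] are protected at
    that round, and nobody is needed before. *)
Lemma containable_sphere g :
  (forall Z0 : set V, finite_set Z0 ->
     exists n, (free_fire Z0 n.+1 #<= `I_(g n.+1))%card) ->
  containable adj g.
Proof.
move=> gF Z0 finZ0; have [n Fg] := gF _ finZ0.
pose F := free_fire Z0.
pose S k := if k == n.+1 then F n.+1 `\` F n else set0.
have S0 k : (k <= n)%N -> protected S k = set0.
  elim: k => //= k IH kn; rewrite IH ?(ltnW kn) // set0U /S ifN //.
  by rewrite eqSS neq_ltn kn.
have SF k : (k <= n)%N -> burning adj Z0 S k = F k.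
  elim: k => // k IH kn; rewrite burningS IH ?(ltnW kn) // S0 //.
  by rewrite /F /free_fire burningS free_protected.
have stop k : burning adj Z0 S (n + k) `<=` F n.
  elim: k => [|k IH]; first by rewrite addn0 SF.
  rewrite addnS burningS => v [/IH //|[nprot [u /IH Fu uv]]].
  apply: contrapT => nFv; apply: nprot.
  suff protN m : (n < m)%N -> S n.+1 `<=` protected S m.
    apply: (protN); first by rewrite ltnS leq_addr.
    rewrite /S eqxx; split=> //; right; split; last by exists u.
    by rewrite free_protected.
  elim: m => // m IHm; rewrite ltnS leq_eqVlt => /predU1P[->|nm] y yS /=; first by right.
  by left; exact: IHm.
have grow k m : burning adj Z0 S k `<=` burning adj Z0 S (k + m).
  elim: m => [|m IH]; first by rewrite addn0.
  by rewrite addnS => v /IH; left.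
exists S; split=> [k|]; last first.
  apply: (@sub_finite_set _ _ (F n.+1)); last by apply: card_le_finite Fg _.
  by move=> v [k _ /(grow _ n)]; rewrite addnC => /stop; left.
rewrite /S eqSS; case: eqP => [->|_]; split=> //.
- rewrite SF // S0 // setU0 => v [_ nF]; exact: nF.
- by apply: card_le_trans Fg; apply: subset_card_le => v [].
Qed.
End Sphere.

Lemma grig_gensP (h : G012) : val h \in grig_gens -> h = ga \/ exists v, h = gbcd v.
Proof.
rewrite !inE => /or4P[] /eqP e; [left | right; exists Lb | right; exists Lc | right; exists Ld];
  exact/val_inj.
Qed.

Lemma grig_gensV (h : G012) : val h \in grig_gens -> (h^-1 = h)%g.
Proof.
move=> /grig_gensP[->|[v ->]]; apply/val_inj; first exact: grig_aV.
exact: tree_bcdV.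
Qed.

Section FastFirefighters.
Variables (R : realType) (eta : R).
Hypothesis eta_root : root ('X^3 + 'X^2 + 'X - 2%:P) eta.
Variables (A : finGroupType) (SA : {set A}).
Local Notation W := (grig_wreath A).
Local Notation adj := (cayley_adj (grig_wreath_gens SA)).

Lemma wlampV (s : A) : ((lamp s)^-1 = lamp s^-1)%g.
Proof. by apply/eqP; rewrite eq_sym -mulg_eq1 lampM mulVg lamp1. Qed.

Lemma wliftV g : ((wlift A g)^-1 = wlift A g^-1)%g.
Proof. by apply/eqP; rewrite eq_sym -mulg_eq1 wliftM mulVg wlift1. Qed.

Lemma word_adj t (z y v : W) : word eta t y -> adj (z * y)%g v ->
  exists t' y', [/\ t' <= t + 1, word eta t' y' & v = (z * y')%g].
Proof.
move=> wy [s sgen vs].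
have {vs sgen} [s' vE sE] : exists2 s', v = (z * y * s')%g &
    (exists r, s' = lamp r) \/ exists2 h : G012, val h \in grig_gens & s' = wlift A h.
  case: vs => vs; [exists s => // | exists s^-1%g; first by rewrite vs mulgK].
    by case: sgen => [[r _ <-]|[h hgen <-]]; [left; exists r | right; exists h].
  case: sgen => [[r _ <-]|[h hgen <-]]; [left; exists r^-1%g; exact: wlampV|].
  by right; exists h; rewrite // [LHS]wliftV grig_gensV.
have /andP[_ wa] := weight_a_bounds eta_root.
case: sE => [[r s'E]|[h /grig_gensP hgen s'E]]; rewrite {}vE {s'}s'E -mulgA.
  by exists t, (y * lamp r)%g; split; [lra | exact: word_lamp |].
case: hgen => [->|[u ->]].
  by exists (t + weight_a eta), (y * wlift A ga)%g; split; [lra | exact: word_a |].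
have /andP[_ wu] := weight_bounds eta_root u.
by exists (t + weight eta u), (y * wlift A (gbcd u))%g; split; [lra | exact: word_bcd |].
Qed.

Lemma free_fire_word Z0 n v : free_fire adj Z0 n v ->
  exists z t y, [/\ Z0 z, t <= n%:R, word eta t y & v = (z * y)%g].
Proof.
elim: n v => [|n IH] v /=.
  by move=> Zv; exists v, 0, 1%g; rewrite mulg1; split=> //; exact: word1.
case=> [/IH[z [t [y [Zz tn wy ->]]]]|[_ [u /IH[z [t [y [Zz tn wy ->]]]]]]].
  by exists z, t, y; split=> //; rewrite -natr1; lra.
move=> /(word_adj wy)[t' [y' [t't wy' ->]]].
by exists z, t', y'; split=> //; rewrite -natr1; lra.
Qed.

(** The fire is covered by translates, by the elements of [Z0], of a set of words
    of small weight. *)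
Lemma card_free_fire (p : R) Z0 : finite_set Z0 -> alpha eta < p -> p < 1 ->
  exists K k : nat, forall n m, 2 * (n%:R + 1) `^ p <= m%:R ->
    (free_fire adj Z0 n #<= `I_(K * k.+1 ^ m)%N)%card.
Proof.
move=> /finite_seqP[Z ZE] ap p1; have [L LP] := short_codes eta_root A ap p1.
have p0 : 0 < p by apply: lt_trans ap; exact: alpha_gt0.
exists (size Z), #|{: 'I_(size L) + bool}| => n m nm.
pose reach := [seq (z * head 1 (foldl (@read A L) [::] (t : m.-tuple (symbol L))))%g
  | z <- Z, t <- enum {: m.-tuple (symbol L)}].
have <- : size reach = (size Z * #|{: 'I_(size L) + bool}|.+1 ^ m)%N.
  by rewrite size_allpairs -cardE card_tuple card_option.
apply: card_le_trans (card_seq_le reach); apply: subset_card_le.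
move=> v /free_fire_word[z [t [y [Zz tn wy ->]]]].
have [c cs cy] := LP _ _ wy.
have cm : (size c <= m)%N.
  rewrite -(ler_nat R); apply: le_trans cs (le_trans _ nm).
  rewrite ler_wpM2l //; have t0 := word_ge0 eta_root wy.
  by apply: ge0_ler_powR; rewrite ?nnegrE ?(ltW p0) //; lra.
have [u uy] := codes_pad cm cy.
apply/allpairsP; exists (z, u) => /=; split; last by rewrite uy.
  by move: Zz; rewrite ZE.
by rewrite mem_enum.
Qed.

Lemma fast_firefighters (gamma : R) : alpha eta < gamma -> gamma < 1 ->
  intermediate_containment adj gamma.
Proof.
move=> ag g1; pose p := (alpha eta + gamma) / 2.
have a0 := alpha_gt0 eta_root.
have ap : alpha eta < p by rewrite /p; lra.
have pg : p < gamma by rewrite /p; lra.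
have p1 : p < 1 by lra.
exists 1, (fun n => Num.truncn (expR (n%:R `^ gamma))); split=> // [n _|].
  by rewrite mul1r truncn_le expR_ge0.
apply: containable_sphere => Z0 finZ0.
have [K [k KP]] := card_free_fire finZ0 ap p1.
have lk : 0 <= ln k.+1%:R :> R by rewrite ln_ge0 // ler1n.
have [N NP] := powR_eventually_le (K%:R + 5 * ln k.+1%:R) ltr01 pg.
exists N; set n := N.+1.
pose m := (Num.truncn (2 * (n%:R + 1) `^ p)).+1.
have np : 1 <= n%:R `^ p :> R.
  have : 1 `^ p <= n%:R `^ p :> R.
    by apply: ge0_ler_powR; rewrite ?nnegrE ?ler1n //; lra.
  by rewrite powR1.
have n1 : 1 <= n%:R :> R by rewrite ler1n.
have m_le : m%:R <= 5 * n%:R `^ p.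
  have n2 : (n%:R + 1) `^ p <= 2 * n%:R `^ p.
    apply: (@le_trans _ _ ((2 * n%:R) `^ p)).
      by apply: ge0_ler_powR; rewrite ?nnegrE; lra.
    rewrite powRM //; apply: ler_wpM2r; first exact: powR_ge0.
    by rewrite -[leRHS]powRr1 // ler_powR //; lra.
  have : (Num.truncn (2 * (n%:R + 1) `^ p))%:R <= 2 * (n%:R + 1) `^ p.
    by rewrite truncn_le mulr_ge0 // powR_ge0.
  by rewrite /m -natr1; lra.
apply: card_le_trans (KP n m _) _; first by rewrite ltW // truncnS_gt.
rewrite card_le_II truncn_ge_nat ?expR_ge0 //.
apply: (@le_trans _ _ (expR ((K%:R + 5 * ln k.+1%:R) * n%:R `^ p))); last first.
  by rewrite ler_expR -[leRHS]mul1r; exact: NP.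
rewrite mulrDl expRD natrM natrX; apply: ler_pM; rewrite ?exprn_ge0 //.
  apply: (@le_trans _ _ (expR K%:R)); first by apply: le_trans (expR_ge1Dx _); lra.
  by rewrite ler_expR ler_peMr.
rewrite -[X in X ^+ m]lnK ?posrE ?ltr0n // -expRM_natl ler_expR.
by rewrite -mulrA mulrCA mulrC ler_wpM2l.
Qed.
End FastFirefighters.

Theorem corollary6p2 (R : realType) (eta : R)
  (eta_root : root ('X^3 + 'X^2 + 'X - 2%:P) eta)
  (A : finGroupType) (cardA : (3 <= #|A|)%N)
  (SA : {set A}) (SA_gen : <<SA>>%g = [set: A]%g)
  (SA_sym : forall s : A, s \in SA -> (s^-1)%g \in SA)
  (SA_not1 : 1%g \notin SA) :
  is_critical_parameter (cayley_adj (grig_wreath_gens SA))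
    (ln 2 / ln (2 / eta)).
Proof.
move=> gamma /andP[gamma0 gamma1]; split; first by move/fast_firefighters; apply.
move=> gamma_lt [C [g [C0 gC contain]]].
(* An element of [SA] provides the second state of the lamps. *)
have [s sSA] : exists s, s \in SA.
  apply/set0Pn; apply: contraTneq cardA => SA0.
  by rewrite -cardsT -SA_gen SA0 gen0 cards1.
have s1 : s <> 1%g by move=> s1; move: SA_not1; rewrite -s1 sSA.
have [r small] := slow_firefighters eta_root gamma0 gamma_lt C0 gC.
exact: grig_wreath_not_containable sSA s1 small contain.
Qed.
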